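(* Let $A_0$ be the initial arc of a connected PCA model $\mathbf M$ with $n$ arcs, let $k$ be an integer with $1\le k<\omega(\mathbf M)$, and let $c=\ell\cdot\mathrm{ratio}^k+e$, $\ell=e^3$, and $e=4n$. The following statements are equivalent: 1. $\mathbf M$ is equivalent to a $k$-multiplicative UCA model. 2. $\mathrm{ratio}^k<\mathrm{RATIO}^k$. 3. $\mathrm{lex}^k(W)<(0,0)$ for every cycle $W$ of $\mathbf S^k$. 4. $\mathbf R^k$ is acyclic. 5. $\mathbf d\,\mathrm{sep}_{c,\ell}(\mathbf S^k,A_0,A)=\mathbf d^*\mathrm{sep}_{c,\ell}(\mathbf R^k,A_0,A)$ for every $A\in\mathcal A(\mathbf M)$.
   Context: **PCA models.** Arcs are open arcs of a circle. Every circle $C$ (of length $|C|$) has a special point $0$, and each point $p$ is identified with the length of the clockwise segment from $0$ to $p$; so $p<q$ iff $p$ appears before $q$ in a clockwise traversal from $0$. For points $s\ne t$, $(s,t)$ is the arc going clockwise from $s$ to $t$; an arc $A=(s,t)$ has beginning point $s(A)=s$ and ending point $t(A)=t$, its extremes. $A$ is external if $A\cup\{t(A)\}$ contains $0$ (in other words, $t(A)<s(A)$) and internal otherwise. $A<B$ means $s(A)<s(B)$. A proper circular-arc (PCA) model is a pair $\mathbf M=(C,\mathcal A)$ where $C$ is a circle and $\mathcal A=\mathcal A(\mathbf M)$ is a family of inclusion-free arcs of $C$, no two of which share an extreme. Its arcs are $A_0<\dots<A_{n-1}$; $A_0$ is the initial arc. $\mathbf M$ is connected if the intersection graph of its arcs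 is connected, and PIG if it has no external arcs. PCA models $\mathbf M,\mathbf M'$ are equivalent if there is a bijection $f:\mathcal A(\mathbf M)\to\mathcal A(\mathbf M')$ such that $a(A)<b(B)$ if and only if $a(f(A))<b(f(B))$, for $a,b\in\{s,t\}$; that is, their extremes appear in the same order when the circles are traversed clockwise from their $0$ points. **Functions on arcs** (subindices mod $n$). A sequence $A_i,A_{i+1},\dots,A_{i+m}$ is contiguous, with leftmost arc $A_i$ and rightmost arc $A_{i+m}$. $L(A_i)=A_{i-1}$, $R(A_i)=A_{i+1}$. $F_l(A_i)$ is the leftmost arc of the contiguous sequence of arcs with ending point in $A_i\cup\{t(A_i)\}$ that has $A_i$ as its rightmost arc; $F_r(A_i)$ is the rightmost arc of the contiguous sequence of arcs with beginning point in $A_i\cup\{s(A_i)\}$ that has $A_i$ as its leftmost arc. $H_l(A_i)$ is the unique arc $A$ such that $F_r(A)=A_i$ and $F_r(R(A))\ne A_i$, and $H_l(A_i)=\bot$ if such $A$ does not exist; $H_r(A_i)$ is the unique arc $A$ such that $F_l(A)=A_i$ and $F_l(L(A))\ne A_i$, and $H_r(A_i)=\bot$ if such $A$ does not exist. $f^j$ is the $j$-th iterate of $f$ ($f^0(A)=A$, and $f^{j+1}(A)=\bot$ if $f^j(A)=\bot$). **Powers.** For $j\ge0$, $A^j=(s(A),\,s(F_r^j(A))+\varepsilon(x+1))$, where $x$ is the number of arcs $B$ with $s(A)\in B$ and $F_r^j(B)=F_r^j(A)$, and the positive number $\varepsilon<1/n$ is small enough so that $t(A^j)\notin R(F_r^j(A))$.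 $\mathbf M^j=(C,\{A^j:A\in\mathcal A\})$. $\omega(\mathbf M)$ is $n$ if $\mathbf M$ is PIG, and otherwise it is the minimum $\omega>1$ for which there is an arc $A$ with $A^\omega\subset A$. **Multiplicative models.** A UCA model is a PCA model whose arcs all have the same length. A $(c',\ell'+1)$-CA model is a UCA model whose circle has length $c'$ and whose arcs have length $\ell'+1$, where $c'$, $\ell'$ and all the extremes are integers. For such a model $\mathbf U$ and $i\ge0$, $i\times\mathbf U$ has the same circle and the arcs $(s(A),\,s(A)+i\ell'+1 \bmod c')$ for $A\in\mathcal A(\mathbf U)$. $\mathbf U$ is $k$-multiplicative when $i\times\mathbf U$ is a UCA model equivalent to $\mathbf U^i$ for every $0\le i\le k$. **Synthetic graph.** A $1$-hollow is an edge $B\to A$ for arcs $A,B$ with $s(B)\in A^1$, $B=F_r(A)$ and $A=F_l(B)$. An $i$-nose ($i\ge0$) is an edge $A\to B$ for arcs $A,B$ with $s(B)\notin A^i$ and $A=H_l^i(L(B))$. $\mathbf S_*^k$ is the directed multigraph with vertex set $\mathcal A(\mathbf M)$ whose edges are the $1$-hollows (hollows) and the $i$-noses for $0\le i\le k$. An $i$-nose $A\to B$ is short when $i<k$ and either $H_l(A)\ne\bot$ or $H_r(B)\ne\bot$. $\mathbf S^k$ is obtained from $\mathbf S_*^k$ by removing all the short noses. A path is a walk with pairwise different vertices; a cycle is a walk $v_0,\dots,v_j$ ($j\ge1$) with $v_j=v_0$ such that $v_0,\dots,v_{j-1}$ is a path; a digraph is acyclic if it has no cycles. **Weights** (the weight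 of a walk is the sum of the weights of its edges). $\mathrm{bal}$ is $-1$ on a $1$-hollow and $i$ on an $i$-nose. $\mathrm{ext}(A\to B)$ is, for a hollow, $1$ if $B\ge A$ and $0$ otherwise; for a nose, $-1$ if $A\ge B$ and $0$ otherwise. $\mathrm{sep}_{c,\ell}$ equals $\ell\,\mathrm{bal}+c\,\mathrm{ext}$ on hollows and $\ell\,\mathrm{bal}+c\,\mathrm{ext}+2$ on noses. For a cycle $W$ with $\mathrm{ext}(W)\ne0$, $\mathrm{ratio}(W)=-\mathrm{bal}(W)/\mathrm{ext}(W)$. $\mathrm{ratio}^k=\max\{\mathrm{ratio}(W): W\text{ is a cycle of }\mathbf S^k\text{ with }\mathrm{ext}(W)<0\}$ and $\mathrm{RATIO}^k=\min\{\mathrm{ratio}(W): W\text{ is a cycle of }\mathbf S^k\text{ with }\mathrm{ext}(W)>0\}$, with $\mathrm{RATIO}^k=\infty$ when every cycle of $\mathbf S^k$ has $\mathrm{ext}\le0$. $\mathrm{len}^k(A\to B)=\mathrm{bal}(A\to B)+\mathrm{ratio}^k\,\mathrm{ext}(A\to B)$ and $\mathrm{lex}^k(A\to B)=(\mathrm{len}^k(A\to B),\mathrm{ext}(A\to B))$; pairs are added coordinatewise and compared lexicographically. **Distances.** For a weighting $w$ of a digraph $D$, $\mathbf d w(D,u,v)$ is the maximum of $w(W)$ among the walks $W$ of $D$ from $u$ to $v$ ($\infty$ if unbounded), and $\mathbf d^*w(D,u,v)$ is the maximum of $w(W)$ among the paths $W$ from $u$ to $v$. An edge $A\to B$ of $\mathbf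 S^k$ is redundant when $\mathbf d\,\mathrm{lex}^k(\mathbf S^k,A_0,B)>\mathbf d\,\mathrm{lex}^k(\mathbf S^k,A_0,A)+\mathrm{lex}^k(A\to B)$. $\mathbf R^k$ is the spanning subgraph of $\mathbf S^k$ obtained by removing all the redundant edges.
   Formalization: M is assumed to have no ending point between 0 and s(A_0); in A^j the rank x counts B with s(A) in B∪F_r(B)∪…∪F_r^{j-1}(B), not just in B; ε is so small that no extreme of M, nor 0, lies between s(F_r^j(A)) and t(A^j); in 5 both distances must be finite. *)

(* Defs.v *)
From mathcomp Require Import all_boot all_order all_algebra.
From mathcomp Require Import boolp classical_sets reals constructive_ereal.
Set Implicit Arguments.
Unset Strict Implicit.
Unset Printing Implicit Defensive.
Import Order.TTheory GRing.Theory Num.Theory.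
Local Open Scope classical_set_scope.
Local Open Scope ring_scope.

(* A circle of length [clen] is parametrized clockwise from its special point
   by [0, clen[.  The arcs of a family are indexed by 'I_n; in a PCA model the
   index order is the order of the beginning points, so the index i denotes
   A_i. *)
Record arc_family (R : realType) (n : nat) := ArcFamily {
  clen : R;
  abeg : 'I_n -> R;
  aend : 'I_n -> R
}.

Definition extreme (R : realType) n (M : arc_family R n) (b : bool) (A : 'I_n) :=
  if b then aend M A else abeg M A.

(* p belongs to the open arc going clockwise from s to t, for s <> t. *)
Definition in_arc (R : realType) (s t p : R) : bool :=
  if s < t then s < p < t else (s < p) || (p < t).

Definition arc_points (R : realType) n (M : arc_family R n) (A : 'I_n) : set R :=
  [set p | 0 <= p < clen M /\ in_arc (abeg M A) (aend M A) p].

Definition external (R : realType) n (M : arc_family R n) (A : 'I_n) : bool :=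
  aend M A < abeg M A.

Definition is_pig (R : realType) n (M : arc_family R n) : bool :=
  [forall A, ~~ external M A].

Definition is_pca (R : realType) n (M : arc_family R n) : Prop :=
  [/\ 0 < clen M,
      forall b A, 0 <= extreme M b A < clen M,
      forall a b A B, extreme M a A = extreme M b B -> (a, A) = (b, B),
      forall A B : 'I_n, (A < B)%N -> abeg M A < abeg M B
    & forall A B, arc_points M A `<=` arc_points M B -> A = B].

Definition arcs_meet (R : realType) n (M : arc_family R n) : rel 'I_n :=
  fun A B => `[< arc_points M A `&` arc_points M B !=set0 >].

Definition connected_model (R : realType) n (M : arc_family R n) : Prop :=
  forall A B, connect (arcs_meet M) A B.

Definition equivalent (R : realType) n m
    (M : arc_family R n) (M' : arc_family R m) : Prop :=
  exists f : 'I_n -> 'I_m, bijective f /\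
    forall a b A B, (extreme M a A < extreme M b B) =
                    (extreme M' a (f A) < extreme M' b (f B)).

(* The beginning point of A0 is the first extreme found clockwise from 0.  This
   fixes the position of 0 and is automatic when all the arcs are internal.  It
   matters because equivalence compares orders from 0: if some ending point lay
   between 0 and the first beginning point then, the ending points of U^1 being
   placed just after beginning points, no U equivalent to the model would be
   equivalent to U^1. *)
Definition zero_normalized (R : realType) n (M : arc_family R n) (A0 : 'I_n) :=
  forall b A, abeg M A0 <= extreme M b A.

(* Last element of the longest run A, step A, step (step A), ... of pairwise
   different arcs that satisfy P. *)
Definition farthest n (step : 'I_n -> 'I_n) (P : pred 'I_n) (A : 'I_n) : 'I_n :=
  iter (\max_(m < n | [forall j : 'I_n, (j <= m)%N ==> P (iter j step A)]) m)
       step A.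

Definition La n (A : 'I_n) : 'I_n := ord_pred A.
Definition Ra n (A : 'I_n) : 'I_n := ordS A.

Definition Fl (R : realType) n (M : arc_family R n) (A : 'I_n) : 'I_n :=
  farthest (@La n) (fun B => in_arc (abeg M A) (aend M A) (aend M B)
                             || (aend M B == aend M A)) A.

Definition Fr (R : realType) n (M : arc_family R n) (A : 'I_n) : 'I_n :=
  farthest (@Ra n) (fun B => in_arc (abeg M A) (aend M A) (abeg M B)
                             || (abeg M B == abeg M A)) A.

(* None stands for bottom; in a PCA model at most one arc can be picked. *)
Definition Hl (R : realType) n (M : arc_family R n) (A : 'I_n) : option 'I_n :=
  [pick B | (Fr M B == A) && (Fr M (Ra B) != A)].

Definition Hr (R : realType) n (M : arc_family R n) (A : 'I_n) : option 'I_n :=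
  [pick B | (Fl M B == A) && (Fl M (La B) != A)].

Definition Hl_iter (R : realType) n (M : arc_family R n) (i : nat) (A : 'I_n) :
    option 'I_n :=
  iter i (obind (Hl M)) (Some A).

(* The rank orders the ending points of the arcs A^j with a common value of
   F_r^j(A).  It counts the arcs B such that s(A) lies in the union of
   B, F_r(B), ..., F_r^(j-1)(B), which is just B when j = 1.  Asking s(A) \in B
   for j > 1 as well makes no difference as long as F_r has no fixed point, but
   in the interval model ]0,2[, ]1,4[, ]3,5[ it would give the second and third
   arcs of the second power the same ending point. *)
Definition pow_rank (R : realType) n (M : arc_family R n) (j : nat) (A : 'I_n) :
    nat :=
  #|[pred B | (iter j (Fr M) B == iter j (Fr M) A) &&
      [exists i : 'I_j, let X := iter i (Fr M) B in
         in_arc (abeg M X) (aend M X) (abeg M A)]]|.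

Definition pow_end (R : realType) n (M : arc_family R n) (j : nat) (e : R)
    (A : 'I_n) : R :=
  abeg M (iter j (Fr M) A) + e * (pow_rank M j A).+1%:R.

(* e is so small that, going clockwise from s(F_r^j(A)) to the ending point of
   A^j, one meets neither an extreme of M nor the point 0; in particular the
   beginning point of R(F_r^j(A)) is not reached.  When the extremes and the
   length of the circle are integers, this holds for every 0 < e < 1/n. *)
Definition small_eps (R : realType) n (M : arc_family R n) (j : nat) (e : R) :
    Prop :=
  0 < e < n%:R^-1 /\
  forall A, pow_end M j e A < clen M /\
    forall b B,
      ~ (abeg M (iter j (Fr M) A) < extreme M b B <= pow_end M j e A).

Definition power (R : realType) n (M : arc_family R n) (j : nat) :
    arc_family R n :=
  ArcFamily (clen M) (abeg M)
    (pow_end M j (xget 0 [set e : R | small_eps M j e])).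

Definition wraps (R : realType) n (M : arc_family R n) (w : nat) : Prop :=
  (1 < w)%N /\ exists A, arc_points (power M w) A `<=` arc_points M A.

Definition omega (R : realType) n (M : arc_family R n) : nat :=
  if is_pig M then n
  else xget 0%N [set w | wraps M w /\ forall w', wraps M w' -> (w <= w')%N].

Definition arc_len (R : realType) n (M : arc_family R n) (A : 'I_n) : R :=
  if external M A then aend M A - abeg M A + clen M else aend M A - abeg M A.

Definition is_uca (R : realType) n (M : arc_family R n) : Prop :=
  is_pca M /\ forall A B, arc_len M A = arc_len M B.

Definition is_ca (R : realType) n (c' l' : nat) (U : arc_family R n) : Prop :=
  [/\ is_uca U, clen U = c'%:R, forall A, arc_len U A = l'.+1%:R
    & forall b A, extreme U b A \is a Num.int].

Definition modr (R : realType) (x c : R) : R :=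
  x - c * (Num.floor (x / c))%:~R.

Definition times (R : realType) n (l' i : nat) (U : arc_family R n) :
    arc_family R n :=
  ArcFamily (clen U) (abeg U)
    (fun A => modr (abeg U A + (i * l').+1%:R) (clen U)).

Definition k_multiplicative (R : realType) n (k : nat) (U : arc_family R n) :
    Prop :=
  exists c' l' : nat, is_ca c' l' U /\
    forall i, (i <= k)%N ->
      is_uca (times l' i U) /\ equivalent (times l' i U) (power U i).

(* (None, A, B) is a hollow A -> B and (Some i, A, B) is an i-nose A -> B. *)
Definition edge (n k : nat) : Type := (option 'I_k.+1 * 'I_n * 'I_n)%type.

Definition kind n k (x : edge n k) : option 'I_k.+1 := x.1.1.
Definition src n k (x : edge n k) : 'I_n := x.1.2.
Definition tgt n k (x : edge n k) : 'I_n := x.2.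

Definition is_hollow (R : realType) n (M : arc_family R n) (B A : 'I_n) : bool :=
  [&& in_arc (abeg (power M 1) A) (aend (power M 1) A) (abeg M B),
      B == Fr M A & A == Fl M B].

Definition is_nose (R : realType) n (M : arc_family R n) (i : nat)
    (A B : 'I_n) : bool :=
  ~~ in_arc (abeg (power M i) A) (aend (power M i) A) (abeg M B) &&
  (Hl_iter M i (La B) == Some A).

Definition Sstar (R : realType) n (M : arc_family R n) (k : nat) :
    {set edge n k} :=
  [set x | if kind x is Some i then is_nose M i (src x) (tgt x)
           else is_hollow M (src x) (tgt x)].

Definition is_short (R : realType) n (M : arc_family R n) (k : nat)
    (x : edge n k) : bool :=
  if kind x is Some i
  then (i < k)%N && ((Hl M (src x) != None) || (Hr M (tgt x) != None))
  else false.

Definition Sgraph (R : realType) n (M : arc_family R n) (k : nat) :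
    {set edge n k} :=
  [set x in Sstar M k | ~~ is_short M x].

(* As parallel edges have different weights, a walk is its sequence of edges. *)
Fixpoint walk n k (D : {set edge n k}) (u : 'I_n) (W : seq (edge n k))
    (v : 'I_n) : bool :=
  if W is x :: W' then [&& x \in D, src x == u & walk D (tgt x) W' v]
  else u == v.

Definition is_path n k (D : {set edge n k}) (u : 'I_n) (W : seq (edge n k))
    (v : 'I_n) : bool :=
  walk D u W v && uniq (u :: map (@tgt n k) W).

Definition is_cycle n k (D : {set edge n k}) (W : seq (edge n k)) : Prop :=
  W <> [::] /\ exists u, walk D u W u && uniq (map (@src n k) W).

Definition acyclic n k (D : {set edge n k}) : Prop :=
  ~ exists W, is_cycle D W.

Definition weight n k (V : nmodType) (w : edge n k -> V) (W : seq (edge n k)) :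
    V :=
  \sum_(x <- W) w x.

Definition bal n k (x : edge n k) : int :=
  if kind x is Some i then (i : nat)%:Z else -1.

Definition ext n k (x : edge n k) : int :=
  if kind x is Some _ then (if (tgt x <= src x)%N then -1 else 0)
  else (if (src x <= tgt x)%N then 1 else 0).

Definition sep n k (c l : rat) (x : edge n k) : rat :=
  l * (bal x)%:~R + c * (ext x)%:~R + (if kind x is Some _ then 2 else 0).

Definition ratio n k (W : seq (edge n k)) : rat :=
  - (weight (@bal n k) W)%:~R / (weight (@ext n k) W)%:~R.

Definition is_max d (T : porderType d) (P : set T) (x : T) : Prop :=
  P x /\ forall y, P y -> (y <= x)%O.

Definition is_min d (T : porderType d) (P : set T) (x : T) : Prop :=
  P x /\ forall y, P y -> (x <= y)%O.

Definition neg_ratios (R : realType) n (M : arc_family R n) (k : nat) : set rat :=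
  [set r | exists W, [/\ is_cycle (Sgraph M k) W,
                         weight (@ext n k) W < 0 & r = ratio W]].

Definition pos_ratios (R : realType) n (M : arc_family R n) (k : nat) : set rat :=
  [set r | exists W, [/\ is_cycle (Sgraph M k) W,
                         0 < weight (@ext n k) W & r = ratio W]].

Definition ratiok (R : realType) n (M : arc_family R n) (k : nat) : rat :=
  xget 0 [set r | is_max (neg_ratios M k) r].

Definition RATIOk (R : realType) n (M : arc_family R n) (k : nat) : \bar rat :=
  if `[< pos_ratios M k !=set0 >]
  then EFin (xget 0 [set r | is_min (pos_ratios M k) r])
  else +oo%E.

Definition lexT := (rat *l int)%type.

Definition lex (R : realType) n (M : arc_family R n) k (x : edge n k) :
    rat * int :=
  ((bal x)%:~R + ratiok M k * (ext x)%:~R, ext x).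

Definition lexW (R : realType) n (M : arc_family R n) k (W : seq (edge n k)) :
    lexT :=
  weight (@lex R n M k) W.

(* The maximum of a set of weights, +oo when the set is unbounded and -oo when
   it is empty.  For the lexicographic order, "unbounded" means without maximum:
   the first coordinates can be bounded while the second ones are not. *)
Definition max_or_infty d (T : porderType d) (P : set T) : extended T :=
  if pselect (exists x, is_max P x) is left h then EFin (sval (cid h))
  else if `[< P !=set0 >] then EPInf T else ENInf T.

Definition dist d (T : porderType d) n k (w : seq (edge n k) -> T)
    (D : {set edge n k}) (u v : 'I_n) : extended T :=
  max_or_infty [set x | exists2 W, walk D u W v & x = w W].

Definition path_dist d (T : porderType d) n k (w : seq (edge n k) -> T)
    (D : {set edge n k}) (u v : 'I_n) : extended T :=
  max_or_infty [set x | exists2 W, is_path D u W v & x = w W].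

Definition lex_shift (x : extended lexT) (v : rat * int) : extended lexT :=
  if x is EFin a then EFin (((a : rat * int) + v) : lexT) else x.

Definition ext_lt d (T : porderType d) (x y : extended T) : bool :=
  match x, y with
  | EFin a, EFin b => (a < b)%O
  | ENInf, EFin _ | ENInf, EPInf | EFin _, EPInf => true
  | _, _ => false
  end.

Definition redundant (R : realType) n (M : arc_family R n) k (A0 : 'I_n)
    (x : edge n k) : bool :=
  ext_lt
    (lex_shift (dist (@lexW R n M k) (Sgraph M k) A0 (src x)) (lex M x))
    (dist (@lexW R n M k) (Sgraph M k) A0 (tgt x)).

Definition Rgraph (R : realType) n (M : arc_family R n) k (A0 : 'I_n) :
    {set edge n k} :=
  [set x in Sgraph M k | ~~ redundant M A0 x].

(* Main.v *)
(** Lift the arcs to the integers, x being the arc with index x mod n, and let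
    f lift F_r and g lift F_l: f is monotone, commutes with x |-> x + n, and
    g x <= y iff x <= f y.  For k < omega(M) an i-nose lifts to x -> f^i(x) + 1,
    a hollow to f(a) -> a, and -ext is the winding of the head.

    A k-multiplicative model equivalent to M is an increasing p : Z -> Z with
    p(x + n) = p(x) + c, p(f x) <= p(x) + l and p(f^i(x) + 1) >= p(x) + i l + 2
    for i <= k.  The edges of S^k carry only part of these inequalities; the
    heart of the proof is that they imply the others.  If H_l(x) exists, the
    inequality of a short nose leaving x follows from those of a hollow, of the
    0-noses inside the fibre f^-1(x) and of a longer nose.  Following the noses
    that end just after a fixed pair y, y + 1 with f(y) = f(y + 1), the slack at x
    is at least the sum of the slacks over f^-1(x), and summing over a period
    excludes a negative defect.  The noses with H_r are treated by the duality
    x |-> -x, which exchanges f and g.  The same implication, for a potential that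
    is shifted on the unreachable arcs, shows that A_0 reaches every arc when all
    the cycles have negative weight.

    A cycle with ext = 0 has bal < 0 because a walk with balance b from x stays
    above f^b(x).  The other implications are about longest walks: cycles that are
    not lex-negative consist of non-redundant edges, and the choice of e makes
    sep refine lex on walks with at most n edges. *)
Require Import Defs.
From mathcomp Require Import all_boot all_order all_algebra.
From mathcomp Require Import boolp classical_sets reals constructive_ereal.
From mathcomp Require Import zify ring lra.
Import Order.TTheory GRing.Theory Num.Theory.
Set Implicit Arguments.
Unset Strict Implicit.
Unset Printing Implicit Defensive.
Local Open Scope classical_set_scope.
Local Open Scope ring_scope.

(** * Monotone maps of the integers that commute with a translation *)

Record circle_map (n : nat) (f g : int -> int) : Prop := CircleMap {
  cm_gal : forall x y, (x <= f y) = (g x <= y);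
  cm_per : forall x, f (x + n%:Z) = f x + n%:Z;
  cm_ge : forall x, x <= f x
}.

Section CircleMap.
Variables (n : nat) (f g : int -> int).
Hypothesis fg : circle_map n f g.

Lemma cm_mono x y : x <= y -> f x <= f y.
Proof. by move=> xy; rewrite (cm_gal fg) (le_trans _ xy) // -(cm_gal fg). Qed.

Lemma cm_adj_mono x y : x <= y -> g x <= g y.
Proof. by move=> xy; rewrite -(cm_gal fg) (le_trans xy) // (cm_gal fg). Qed.

Lemma cm_adj_le x : g x <= x.
Proof. by rewrite -(cm_gal fg) (cm_ge fg). Qed.

Lemma cm_adj_per x : g (x + n%:Z) = g x + n%:Z.
Proof.
have H y : (g (x + n%:Z) <= y) = (g x + n%:Z <= y).
  rewrite -(cm_gal fg) -[y in f y](subrK n%:Z) (cm_per fg) lerD2r (cm_gal fg).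
  by rewrite lerBrDr.
by apply/eqP; rewrite eq_le H lexx -H lexx.
Qed.

Lemma cm_gt x y : (f y < x) = (y < g x).
Proof. by rewrite !ltNge (cm_gal fg). Qed.

Lemma iter_cm_mono i x y : x <= y -> iter i f x <= iter i f y.
Proof. by move=> xy; elim: i => //= i; apply: cm_mono. Qed.

Lemma iter_cm_ge i x : x <= iter i f x.
Proof. by elim: i => //= i IH; apply: le_trans IH (cm_ge fg _). Qed.

Lemma iter_cm_le i j x : (i <= j)%N -> iter i f x <= iter j f x.
Proof. by move=> ij; rewrite -(subnK ij) iterD iter_cm_ge. Qed.

Lemma iter_cm_per i x : iter i f (x + n%:Z) = iter i f x + n%:Z.
Proof. by elim: i => //= i ->; rewrite (cm_per fg). Qed.

Lemma per_mulz (V : zmodType) (h : int -> V) (c : V) :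
  (forall x, h (x + n%:Z) = h x + c) -> forall x q, h (x + n%:Z * q) = h x + c *~ q.
Proof.
move=> hn x; elim/int_rec => [|m IH|m IH]; first by rewrite mulr0 mulr0z !addr0.
  by rewrite intS mulrDr mulr1 addrCA addrC hn IH mulrzDr mulr1z -addrA (addrC c).
rewrite -(addrK c (h _)) -hn.
have -> : x + n%:Z * - m.+1%:Z + n%:Z = x + n%:Z * - m%:Z by lia.
by rewrite IH -addn1 PoszD opprD mulrzDr mulrN1z addrA.
Qed.

(** Reflecting the line exchanges upper and lower adjoints, so that statements about [f] have mirror
    images about [g]. *)
Lemma circle_map_dual : circle_map n (fun x => - g (- x)) (fun x => - f (- x)).
Proof.
split=> [x y|x|x].
- by rewrite lerNr -(cm_gal fg) lerNl.
- by rewrite -[in RHS](subrK n%:Z (- x)) cm_adj_per opprD [- (_ + n%:Z)]opprD subrK.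
- by have := cm_adj_le (- x); lia.
Qed.

(** The sum over the integers from a to b - 1; because of the absolute value it has this meaning
    only for a <= b. *)
Definition per_sum (V : zmodType) (e : int -> V) (a b : int) : V :=
  \sum_(0 <= j < (absz (b - a)%R)) e (a + j%:Z).

Lemma per_sum_cat (V : zmodType) (e : int -> V) (a b c : int) : a <= b -> b <= c ->
  per_sum e a c = per_sum e a b + per_sum e b c.
Proof.
move=> ab bc; rewrite /per_sum.
have -> : (absz (c - a)%R) = (absz (b - a)%R + absz (c - b)%R)%N by lia.
rewrite (@big_cat_nat _ _ _ (absz (b - a)%R)) ?leq_addr //=; congr (_ + _).
rewrite -{1}[(absz (b - a)%R) in X in \sum_(X <= _ < _) _]add0n big_addn.
rewrite addKn; apply: eq_bigr => j _; congr e; lia.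
Qed.

Lemma per_sum1 (V : zmodType) (e : int -> V) a : per_sum e a (a + 1) = e a.
Proof.
by rewrite /per_sum addrAC subrr add0r absz1 big_nat1 addr0.
Qed.

Lemma per_sumxx (V : zmodType) (e : int -> V) a : per_sum e a a = 0.
Proof. by rewrite /per_sum subrr big_geq. Qed.

Lemma per_sum_shift (V : zmodType) (e : int -> V) :
  (forall x, e (x + n%:Z) = e x) ->
  forall a, per_sum e a (a + n%:Z) = per_sum e 0 n%:Z.
Proof.
move=> en.
have step a : per_sum e (a + 1) (a + 1 + n%:Z) = per_sum e a (a + n%:Z).
  apply: (@addrI _ (e a)); rewrite -{1}(per_sum1 e a) -per_sum_cat; [|lia|lia].
  rewrite (addrAC a) (@per_sum_cat _ _ a (a + n%:Z)); [|lia|lia].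
  by rewrite per_sum1 en addrC.
elim/int_rec => [|m IH|m IH]; first by rewrite add0r.
  by rewrite -addn1 PoszD step.
rewrite -IH; have := step (- m.+1%:Z); have -> : - m.+1%:Z + 1 = - m%:Z by lia.
by move=> ->.
Qed.

(* A function that dominates its sums over the fibres of f has the same total as
   them over a period, so that it is equal to them. *)
Lemma fibre_sum_eq (F : numDomainType) (e : int -> F) :
  (0 < n)%N ->
  (forall x, e (x + n%:Z) = e x) ->
  (forall x, per_sum e (g x) (g (x + 1)) <= e x) ->
  forall x, per_sum e (g x) (g (x + 1)) = e x.
Proof.
move=> n0 en le a; set phi := fun x => per_sum e (g x) (g (x + 1)).
(* The fibre of [f] over x is the interval from [g x] to [g (x + 1) - 1], so fibres over consecutive
   points are adjacent and their sums telescope. *)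
have tel m : \sum_(0 <= i < m) phi (a + i%:Z) = per_sum e (g a) (g (a + m%:Z)).
  elim: m => [|m IH]; first by rewrite big_geq // addr0 per_sumxx.
  rewrite big_nat_recr //= IH /phi -per_sum_cat ?cm_adj_mono //; [|lia|lia].
  by rewrite -addrA -addn1.
have tot : \sum_(0 <= i < n) (e (a + i%:Z) - phi (a + i%:Z)) = 0.
  rewrite sumrB tel cm_adj_per per_sum_shift // -(per_sum_shift en a).
  by rewrite /per_sum addrAC subrr add0r subrr.
have ge0 (i : 'I_n) : true -> 0 <= e (a + i%:Z) - phi (a + i%:Z).
  by rewrite subr_ge0 => _; apply: le.
have := tot; rewrite big_mkord => /(psumr_eq0P ge0)/(_ (Ordinal n0) isT).
by rewrite /= addr0 => /eqP; rewrite subr_eq0 => /eqP.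
Qed.

(* x is the value of H_l^i at f^i(x). *)
Definition chain (i : nat) (x : int) : Prop :=
  forall j, (j < i)%N -> g (iter j.+1 f x + 1) = iter j f x + 1.

(* The inequalities of the hollows and of the noses that are not short: H_l(x)
   is undefined iff g x = g (x + 1), and H_r(y + 1) iff f y = f (y + 1). *)
Record seps (F : realFieldType) (k : nat) (p : int -> F) (c l : F) : Prop := Seps {
  seps_per : forall x, p (x + n%:Z) = p x + c;
  seps_hollow : forall a b, f a = b -> g b = a -> p b <= p a + l;
  seps_nose : forall i x, (i <= k)%N -> chain i x ->
    i = k \/ (g x = g (x + 1) /\ f (iter i f x) = f (iter i f x + 1)) ->
    p x + i%:R * l + 2 <= p (iter i f x + 1)
}.

(** * Slack of the noses and its propagation along the fibres of [f] *)

Section Right.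
Variables (F : realFieldType) (k : nat) (p : int -> F) (c l : F).
Hypothesis n_gt0 : (0 < n)%N.
Hypothesis k_gt0 : (0 < k)%N.
Hypothesis pS : seps k p c l.

(* gap x is the slack of the nose x -> f^i(x) + 1, for the least i < k such that
   f takes the same value at f^i(x) and f^i(x) + 1, and for i = k if there is
   none. *)
Let flat i x := f (iter i f x) == f (iter i f x + 1).
Let idx x := find (fun i => flat i x) (iota 0 k).
Let gap x := p (iter (idx x) f x + 1) - p x - (idx x)%:R * l.
Let defect x := Num.min (gap x - 2) 0.

Let idx_le x : (idx x <= k)%N.
Proof.
by have := find_size (fun i => flat i x) (iota 0 k); rewrite size_iota.
Qed.

Let idx_flat x : (idx x < k)%N -> flat (idx x) x.
Proof.
move=> lt; have : has (fun i => flat i x) (iota 0 k) by rewrite has_find size_iota.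
by move=> /(nth_find 0%N); rewrite -/(idx x) nth_iota.
Qed.

Let idx_before x j : (j < idx x)%N -> ~~ flat j x.
Proof.
move=> jx; have := @before_find _ 0%N (fun i => flat i x) (iota 0 k) j jx.
by rewrite nth_iota ?(leq_trans jx) // => ->.
Qed.

Let idx_uniq x i : (i < k)%N -> flat i x -> (forall j, (j < i)%N -> ~~ flat j x) ->
  idx x = i.
Proof.
move=> ik fi before; apply/eqP; rewrite eqn_leq leqNgt; apply/andP; split.
  by apply/negP => /idx_before; rewrite fi.
rewrite leqNgt; apply/negP => lt; have := before _ lt.
by rewrite idx_flat // (ltn_trans lt).
Qed.

(** If [f] separates v from v + 1, then v + 1 is the least point sent beyond [f v], that is
    [g (f v + 1) = v + 1]. Before the index [idx x] this happens at every iterate v of x. *)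
Let chain_idx x : chain (idx x) x.
Proof.
move=> j /idx_before; rewrite /flat /= => /eqP ne.
have := cm_mono (_ : iter j f x <= iter j f x + 1).
have := cm_gt (f (iter j f x) + 1) (iter j f x).
have := cm_gal fg (f (iter j f x) + 1) (iter j f x + 1).
lia.
Qed.

Let gap_good x : (idx x = k \/ g x = g (x + 1)) -> 2 <= gap x.
Proof.
move=> H; have := seps_nose pS (idx_le x) (chain_idx (x := x)).
rewrite /gap; suff: idx x = k \/
    (g x = g (x + 1) /\ f (iter (idx x) f x) = f (iter (idx x) f x + 1)).
  move=> h /(_ h); lra.
case: (ltngtP (idx x) k) (idx_le x) => // [lt _|]; last by left.
by right; split; [case: H => //; move: lt => /[swap] ->; rewrite ltnn
                 |exact/eqP/idx_flat].
Qed.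

(** The last point h of the fibre is H_l(x). Its nose is one longer than that of x and ends at the
    same point; the other points of the fibre have 0-noses, whose gaps telescope to [p h - p (g x)].
    The difference of the two sides is the slack of the hollow from x to [g x]. *)
Let gap_fibre x : (idx x < k)%N -> g x < g (x + 1) ->
  [/\ idx (g (x + 1) - 1) = (idx x).+1 &
      per_sum gap (g x) (g (x + 1)) <= gap x].
Proof.
move=> lt lg; set h := g (x + 1) - 1.
have fh y : g x <= y -> y <= h -> f y = x.
  move=> gy yh; have := cm_gal fg x y; have := cm_gal fg (x + 1) y.
  by rewrite /h in yh; lia.
have fhx : f h = x by apply: fh; rewrite /h; lia.
have it j : iter j.+1 f h = iter j f x by rewrite iterSr fhx.
have nflat : ~~ flat 0 h.
  rewrite /flat /= fhx /h subrK; apply/eqP => E.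
  by have := cm_gal fg (x + 1) (g (x + 1)); rewrite lexx -E; lia.
have fl := idx_flat lt.
have idxh : idx h = (idx x).+1.
  case: (ltngtP (idx x).+1 k) lt => // [lt _|ek _].
    apply: idx_uniq => //; first by rewrite /flat it.
    by case=> [//|j] jx; rewrite /flat it; apply: idx_before.
  case: (ltngtP (idx h) k) (idx_le h) => // [hk _|->]; last by [].
  have := idx_flat hk; case: (idx h) hk => [|j] hk; first by rewrite (negPf nflat).
  by rewrite /flat it => H; have := @idx_before x j; rewrite /flat H; lia.
have gaph : gap x = gap h + p h + l - p x.
  by rewrite /gap idxh it -natr1; ring.
have ph := seps_hollow pS (fh (g x) (lexx _) _) erefl.
have {ph} ph : p x <= p (g x) + l by apply: ph; rewrite /h; lia.
split=> //; rewrite (@per_sum_cat _ _ _ h); [|rewrite /h; lia|rewrite /h; lia].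
rewrite -[g (x + 1)](subrK 1) -/h per_sum1 gaph.
suff tel m : g x + m%:Z <= h ->
    per_sum gap (g x) (g x + m%:Z) = p (g x + m%:Z) - p (g x).
  have := tel (absz (h - g x)%R); have -> : g x + (absz (h - g x)%R) = h by rewrite /h; lia.
  by move=> ->; [lra|exact: lexx].
elim: m => [|m IH] mh; first by rewrite addr0 per_sumxx subrr.
rewrite -addn1 PoszD addrA (@per_sum_cat _ _ _ (g x + m%:Z)); [|lia|lia].
rewrite per_sum1 IH; last lia.
have -> : gap (g x + m%:Z) = p (g x + m%:Z + 1) - p (g x + m%:Z).
  rewrite /gap (@idx_uniq _ 0%N) //= ?mul0r ?subr0 //.
  rewrite /flat /= fh ?(fh (_ + 1)) //; lia.
by lra.
Qed.

Let idx_per x : idx (x + n%:Z) = idx x.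
Proof.
apply: eq_find => i; rewrite /flat iter_cm_per addrAC !(cm_per fg).
by rewrite (inj_eq (addIr _)).
Qed.

Let defect_per x : defect (x + n%:Z) = defect x.
Proof.
rewrite /defect /gap idx_per iter_cm_per (addrAC (iter _ _ _)) !(seps_per pS).
by congr (Num.min _ 0); ring.
Qed.

Let defect_le0 x : defect x <= 0.
Proof. by rewrite /defect ge_min lexx orbT. Qed.

Let per_sum_defect a b :
  per_sum defect a b <= per_sum gap a b - 2 * (absz (b - a)%R)%:R.
Proof.
rewrite /per_sum !big_mkord.
have -> : 2 * (absz (b - a)%R)%:R = \sum_(j < (absz (b - a)%R)) (2 : F).
  by rewrite sumr_const card_ord mulr_natr.
by rewrite -sumrB ler_sum // => j _; rewrite /defect ge_min lexx.
Qed.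

Let bad x : gap x < 2 -> (idx x < k)%N /\ g x < g (x + 1).
Proof.
move=> gx; have good := gap_good (x := x).
have mono := cm_adj_mono (_ : x <= x + 1).
split; first (case: (ltngtP (idx x) k) (idx_le x) => // E _;
              have := good (or_introl E); lra).
rewrite lt_neqAle mono ?andbT; last lia.
by apply/eqP => E; have := good (or_intror E); lra.
Qed.

(** When the defect at x is negative the fibre has m >= 1 points, and the subtraction of 2 at each
    of them lowers the sum of the gaps by 2m, against 2 at x. *)
Let fibre_defect_le x : per_sum defect (g x) (g (x + 1)) <= defect x.
Proof.
case: (ltrP (gap x) 2) => gx; last first.
  have -> : defect x = 0 by apply/min_idPr; rewrite subr_ge0.
  by rewrite /per_sum big_mkord sumr_le0.
have [lt lg] := bad gx; have [_ sum] := gap_fibre lt lg.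
have -> : defect x = gap x - 2 by apply/min_idPl; lra.
have : (1 : F) <= (absz (g (x + 1) - g x)%R)%:R by rewrite ler1n; lia.
by have := per_sum_defect (g x) (g (x + 1)); lra.
Qed.

(** By [fibre_sum_eq] the comparison of defects is an equality. A negative defect then forces a
    fibre with a single point, since each further point would lose another 2. That point has the
    same defect and a larger index, so the induction on [k - idx x] applies to it. *)
Let gap_ge2 x : 2 <= gap x.
Proof.
have [m] := ubnP (k - idx x); elim: m x => // m IH x km.
case: (lerP 2 (gap x)) => // gx; have [lt lg] := bad gx.
have [idxh sum] := gap_fibre lt lg.
have tight := fibre_sum_eq n_gt0 defect_per fibre_defect_le x.
have dx : defect x = gap x - 2 by apply/min_idPl; lra.
have sz := per_sum_defect (g x) (g (x + 1)).
have : ~~ (2 <= absz (g (x + 1) - g x)%R)%N.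
  by apply/negP; rewrite -(ler_nat F) => H; lra.
move=> sz1; have E : g (x + 1) = g x + 1 by lia.
rewrite E per_sum1 in tight; rewrite E addrK in idxh.
have : 2 <= gap (g x) by apply: IH; rewrite idxh; lia.
move=> H; have : defect (g x) = 0 by apply/min_idPr; lra.
by lra.
Qed.

Lemma seps_flat z : f z = f (z + 1) -> p z + 2 <= p (z + 1).
Proof.
move=> fz; have := gap_ge2 z; rewrite /gap (@idx_uniq z 0%N) ?mul0r //=.
  by lra.
by rewrite /flat /= fz.
Qed.

End Right.

End CircleMap.

(** * The separations of the short noses and of all the iterates of [f] *)

Section Noses.
Variables (n : nat) (f g : int -> int).
Hypothesis fg : circle_map n f g.
Variables (F : realFieldType) (k : nat) (p : int -> F) (c l : F).
Hypothesis n_gt0 : (0 < n)%N.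
Hypothesis k_gt0 : (0 < k)%N.
Hypothesis pS : seps n f g k p c l.

Lemma seps_dual :
  seps n (fun x => - g (- x)) (fun x => - f (- x)) k (fun x => - p (- x)) c l.
Proof.
split=> [x|a b gb fa|i x ik ch flat].
- have := seps_per pS (- x - n%:Z); rewrite subrK opprD => ->; ring.
- have := seps_hollow pS (_ : f (- b) = - a) (_ : g (- a) = - b).
  have {}fa : f (- b) = - a by lia.
  have {}gb : g (- a) = - b by lia.
  by move=> /(_ fa gb) ?; lra.
have it j : iter j (fun z => - g (- z)) x = - iter j g (- x).
  by elim: j => [|j IH] /=; rewrite ?opprK // IH opprK.
(* The mirror image of the dual nose at x is the nose from u to y: the iterates of [f] climb from u
   to y - 1 through the points [iter j g y - 1]. *)
set y := - x; set u := iter i g y - 1.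
have back j : (j < i)%N -> f (iter j.+1 g y - 1) = iter j g y - 1.
  by move=> ji; have E := ch _ ji; rewrite !it -/y in E; rewrite -[LHS]opprK -{1}[iter j.+1 g y]opprK -opprD E opprD opprK.
have fu m : (m <= i)%N -> iter m f u = iter (i - m) g y - 1.
  elim: m => [|m IH] mi; first by rewrite subn0.
  rewrite iterS IH; last lia.
  have -> : (i - m)%N = (i - m.+1).+1 by lia.
  by rewrite back //; lia.
have chu : chain f g i u.
  move=> j ji; rewrite !fu //; last lia.
  by rewrite !subrK -iterS (_ : (i - j.+1).+1 = i - j)%N //; lia.
have := seps_nose pS ik chu; rewrite fu // subnn /= (subrK 1 y) /u (subrK 1).
rewrite it -/y opprD opprK -/u.
suff cond : i = k \/ g u = g (iter i g y) /\ f (y - 1) = f y.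
  by move=> /(_ cond); lra.
case: flat => [->|[fx gx]]; [by left|right].
move: gx; rewrite it -/y !opprD !opprK -/u => /oppr_inj gx.
by rewrite gx /y -opprD; split=> //; apply: oppr_inj; rewrite -fx.
Qed.

Lemma seps_adj_flat z : g z = g (z + 1) -> p z + 2 <= p (z + 1).
Proof.
move=> gz; have := seps_flat (circle_map_dual fg) n_gt0 k_gt0 seps_dual (z := - z - 1).
by rewrite subrK opprB opprK addrC -gz => /(_ erefl); lra.
Qed.

Lemma steps_le (a b : int) : a <= b ->
  (forall z, a <= z -> z < b -> p z + 2 <= p (z + 1)) -> p a <= p b.
Proof.
move=> ab H; have -> : b = a + (absz (b - a)%R)%:Z by lia.
have : (absz (b - a)%R)%:Z <= b - a by lia.
elim: (absz (b - a)%R) => [|m IH] mb; first by rewrite addr0.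
have Hm : p (a + m%:Z) + 2 <= p (a + m%:Z + 1) by apply: H; lia.
rewrite -addn1 PoszD addrA; have : p a <= p (a + m%:Z) by apply: IH; lia.
by lra.
Qed.

(** Downward induction on i. If H_l(x) exists, the nose is extended backwards to the last point h of
    the fibre over x, and h is compared with x through a hollow and the 0-noses of the fibre. If H_r
    exists at the end, the nose is extended forwards in the same way, with the 0-noses of a fibre of
    [g]. Otherwise the nose is not short. *)
Lemma seps_chain i x : (i <= k)%N -> chain f g i x ->
  p x + i%:R * l + 2 <= p (iter i f x + 1).
Proof.
have [m] := ubnP (k - i); elim: m i x => // m IH i x km ik ch.
case: (eqVneq i k) => [E|ik']; first by apply: (seps_nose pS) => //; left.
have ik1 : (i < k)%N by lia.
have gal := cm_gal fg; have gm := cm_adj_mono fg (_ : x <= x + 1).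
set v := iter i f x; have fm := cm_mono fg (_ : v <= v + 1).
case: (eqVneq (g x) (g (x + 1))) => [gx|gx]; last first.
  set h := g (x + 1) - 1.
  have fh z : g x <= z -> z <= h -> f z = x.
    by have := gal x z; have := gal (x + 1) z; rewrite /h; lia.
  have fhx : f h = x by apply: fh; rewrite /h; lia.
  have chh : chain f g i.+1 h.
    case=> [_|j ji]; first by rewrite /= fhx /h; lia.
    by rewrite !iterSr fhx -iterSr; apply: ch.
  have := IH i.+1 h _ ik1 chh; rewrite iterSr fhx -/v -natr1 => /(_ ltac:(lia)).
  have := seps_hollow pS (fh (g x) (lexx _) _) erefl => /(_ ltac:(rewrite /h; lia)).
  have : p (g x) <= p h; last by lra.
  apply: steps_le => [|z z1 z2]; first by rewrite /h; lia.
  by apply: (seps_flat fg n_gt0 k_gt0 pS); rewrite !fh //; lia.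
case: (eqVneq (f v) (f (v + 1))) => [fv|fv].
  by apply: (seps_nose pS) => //; right.
have chi : chain f g i.+1 x.
  move=> j; rewrite ltnS leq_eqVlt => /orP[/eqP ->|]; last exact: ch.
  have := gal (f v + 1) (v + 1); have := gal (f v + 1) v.
  by rewrite /= -/v; lia.
have := IH i.+1 x _ ik1 chi; rewrite /= -/v -natr1 => /(_ ltac:(lia)).
have gv z : f v < z -> z <= f (v + 1) -> g z = v + 1.
  by have := gal z v; have := gal z (v + 1); lia.
have := seps_hollow pS (erefl (f (v + 1))) (gv _ _ _).
move=> /(_ ltac:(lia) (lexx _)).
have : p (f v + 1) <= p (f (v + 1)); last by lra.
apply: steps_le => [|z z1 z2]; first by lia.
by apply: seps_adj_flat; rewrite !gv //; lia.
Qed.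

Lemma seps_step x : p x + 2 <= p (x + 1).
Proof. by have := @seps_chain 0 x isT (fun j => ltac:(by [])); rewrite mul0r addr0. Qed.

Lemma seps_mono x y : x <= y -> p x <= p y.
Proof. by move=> xy; apply: steps_le => // z _ _; apply: seps_step. Qed.

Lemma seps_le x : p (f x) <= p x + l.
Proof.
have gal := cm_gal fg.
have gx : g (f x) <= x by rewrite -gal.
have fgx : f (g (f x)) = f x.
  have := cm_mono fg gx; have := gal (f x) (g (f x)); lia.
have := seps_hollow pS fgx erefl; have := seps_mono gx; lra.
Qed.

(** Let h be the last point with the same image as x. Either the iterates of h form a chain, or some
    iterate v has the same image as v + 1; the inequality then follows from a shorter one from h to
    v + 1 and a shorter one from v + 1 onwards. *)
Lemma seps_lt i x : (i <= k)%N -> p x + i%:R * l + 2 <= p (iter i f x + 1).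
Proof.
have gal := cm_gal fg.
have [m] := ubnP i; elim: m i x => // m IH [x|i x im ik].
  by rewrite mul0r addr0 => _ _; apply: seps_step.
set h := g (f x + 1) - 1.
have [xh fh] : x <= h /\ f h = f x.
  have := gal (f x + 1) x; have := gal (f x + 1) h; have := cm_mono fg (_ : x <= h).
  by rewrite /h; lia.
suff : p h + i.+1%:R * l + 2 <= p (iter i.+1 f h + 1).
  by rewrite !iterSr fh; have := seps_mono xh; lra.
case: (boolP [forall j : 'I_i.+1, g (iter j.+1 f h + 1) == iter j f h + 1]).
  by move=> /forallP ch; apply: seps_chain => // j ji; apply/eqP/(ch (Ordinal ji)).
rewrite negb_forall => /existsP[[j ji]] /=; set v := iter j f h => ne.
(* The break is not at h itself, which is the last point of its fibre; hence the second part is also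
   shorter. *)
have j0 : (0 < j)%N.
  case: j ji @v ne => // _ v; rewrite /v /= fh /h subrK eqxx; lia.
have fv : f (v + 1) = f v.
  have := gal (f v + 1) (v + 1); have := gal (f v + 1) v.
  by have := cm_mono fg (_ : v <= v + 1); lia.
have := IH j h _ _ => /(_ ltac:(lia) ltac:(lia)); rewrite -/v.
have := IH (i.+1 - j)%N (v + 1) _ _ => /(_ ltac:(lia) ltac:(lia)).
have -> : iter (i.+1 - j) f (v + 1) = iter i.+1 f h.
  have -> : (i.+1 - j)%N = (i - j).+1 by lia.
  by rewrite iterSr fv -iterSr /v -iterD (_ : (_ + j)%N = i.+1) //; lia.
by rewrite natrB ?mulrBl; [lra|lia].
Qed.
End Noses.

(** * Walks and longest paths *)

Section Walks.
Variables (n k : nat).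
Implicit Types (D : {set edge n k}) (W P Q : seq (edge n k)) (x : edge n k).

Definition walk_end (u : 'I_n) W : 'I_n := last u (map (@tgt n k) W).

Lemma walk_endP D u W v : walk D u W v -> v = walk_end u W.
Proof.
elim: W u => [|x W IH] u /=; first by move/eqP.
by case/and3P=> _ _ /IH.
Qed.

Lemma walk_cat D u W1 W2 v :
  walk D u (W1 ++ W2) v = walk D u W1 (walk_end u W1) && walk D (walk_end u W1) W2 v.
Proof.
elim: W1 u => [|x W1 IH] u /=; first by rewrite eqxx.
by rewrite IH !andbA.
Qed.

Lemma walk_sub D D' u W v : {subset W <= D'} -> walk D u W v -> walk D' u W v.
Proof.
elim: W u => //= x W IH u sub /and3P[_ -> /IH ->].
  by rewrite sub ?mem_head.
by move=> y yW; apply: sub; rewrite inE yW orbT.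
Qed.

Lemma walk_subset D u W v : walk D u W v -> {subset W <= D}.
Proof.
elim: W u => [|x W IH] u //= /and3P[xD _ /IH sub] y.
by rewrite inE => /orP[/eqP ->|/sub].
Qed.

Lemma walk_src D u W v : walk D u W v ->
  map (@src n k) W = belast u (map (@tgt n k) W).
Proof.
elim: W u => //= x W IH u /and3P[_ /eqP -> /IH E].
by rewrite E; case: (W).
Qed.

Lemma weight_cat (V : nmodType) (w : edge n k -> V) W1 W2 :
  weight w (W1 ++ W2) = weight w W1 + weight w W2.
Proof. by rewrite /weight big_cat. Qed.

Lemma weight_cons (V : nmodType) (w : edge n k -> V) x W :
  weight w (x :: W) = w x + weight w W.
Proof. by rewrite /weight big_cons. Qed.

Lemma weight_nil (V : nmodType) (w : edge n k -> V) : weight w [::] = 0.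
Proof. by rewrite /weight big_nil. Qed.

Lemma path_size D u W v : is_path D u W v -> (size W < n)%N.
Proof.
case/andP=> _ /card_uniqP; rewrite /= size_map => <-.
by rewrite -[X in (_ <= X)%N]card_ord max_card.
Qed.

Lemma cycle_size D W : is_cycle D W -> (size W <= n)%N.
Proof.
case=> _ [u /andP[_ /card_uniqP]]; rewrite size_map => <-.
by rewrite -[X in (_ <= X)%N]card_ord max_card.
Qed.

Lemma path_walk D u W v : is_path D u W v -> walk D u W v.
Proof. by case/andP. Qed.

Lemma path_catl D u W1 W2 v : is_path D u (W1 ++ W2) v ->
  is_path D u W1 (walk_end u W1).
Proof.
rewrite /is_path walk_cat => /andP[/andP[-> _]].
by rewrite map_cat -cat_cons cat_uniq => /andP[].
Qed.

(** When an edge is put in front of a path that already visits its source, the closed part up to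
    that visit is a cycle and can be cut off without loss. *)
Lemma path_weight_le (V : nmodType) (w : edge n k -> V) (le : rel V) D :
  reflexive le -> transitive le ->
  (forall a b c, le a b -> le (a + c) (b + c)) ->
  (forall W, is_cycle D W -> le (weight w W) 0) ->
  forall u W v, walk D u W v ->
    exists2 P, is_path D u P v & le (weight w W) (weight w P).
Proof.
move=> le_refl le_tr leD le_cyc u W v; elim: W u => [|x W IH] u.
  by move=> uv; exists [::]; rewrite // /is_path uv.
move=> /and3P[xD /eqP xu /IH[P /andP[wP uP] leP]].
have lexP : le (weight w (x :: W)) (weight w (x :: P)).
  by rewrite !weight_cons ![w x + _]addrC; apply: leD.
have [uin|uin] := boolP (u \in tgt x :: map (@tgt n k) P); last first.
  exists (x :: P) => //; rewrite /is_path /= xD xu eqxx wP /=.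
  by rewrite uin.
have [P1 [P2 [EP lP1]]] : exists P1 P2, P = P1 ++ P2 /\ walk_end (tgt x) P1 = u.
  rewrite inE in uin; case/orP: uin => [/eqP ->|]; first by exists [::], P.
  move=> /mapP[y /(nthP y)[i iP Ei] ->].
  exists (take i.+1 P), (drop i.+1 P); rewrite cat_take_drop; split=> //.
  by rewrite /walk_end (take_nth y) // map_rcons last_rcons Ei.
subst P; rewrite walk_cat lP1 in wP; case/andP: wP => w1 w2.
have uP1 : uniq (tgt x :: map (@tgt n k) P1).
  by move: uP; rewrite map_cat -cat_cons cat_uniq => /andP[].
exists P2.
  rewrite /is_path w2 /=; move: uP.
  rewrite map_cat -cat_cons lastI cat_rcons -[last _ _]/(walk_end _ _) lP1.
  by rewrite cat_uniq => /and3P[].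
apply: le_tr lexP _; rewrite -cat_cons weight_cat -[X in le _ X]add0r.
apply/leD/le_cyc; split=> //; exists u.
rewrite /= xD xu eqxx w1 (walk_src w1) /=.
by move: uP1; rewrite lastI -[last _ _]/(walk_end _ _) lP1 rcons_uniq.
Qed.

End Walks.

(** * Maxima of finite sets and longest walks *)

Lemma finite_max d (T : orderType d) (P : set T) (L : seq T) :
  (exists x, P x) -> (forall x, P x -> x \in L) -> exists x, is_max P x.
Proof.
elim: L P => [|a L IH] P [x Px] sub; first by have := sub _ Px.
have [[y [Py ya]]|no] := pselect (exists y, P y /\ y != a); last first.
  exists a; split=> [|y Py].
    by have [<-//|xa] := eqVneq x a; case: no; exists x.
  by have [->//|ya] := eqVneq y a; case: no; exists y.
have [|z [/sub]|z [[Pz za] zmax]] := IH [set z | P z /\ z != a].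
- by exists y.
- by rewrite inE => /orP[/eqP->|//]; rewrite eqxx.
have [Pa|nPa] := pselect (P a); last first.
  exists z; split=> // t Pt; apply: zmax; split=> //.
  by apply/eqP => ta; apply: nPa; rewrite -ta.
have [az|za'] := leP a z.
  by exists z; split=> // t Pt; have [->//|ta] := eqVneq t a; apply: zmax.
exists a; split=> // t Pt; have [->//|ta] := eqVneq t a.
by apply: le_trans (ltW za'); apply: zmax.
Qed.

Lemma finite_min d (T : orderType d) (P : set T) (L : seq T) :
  (exists x, P x) -> (forall x, P x -> x \in L) -> exists x, is_min P x.
Proof. exact: (@finite_max _ T^d). Qed.

Lemma is_max_uniq d (T : orderType d) (P : set T) (x y : T) :
  is_max P x -> is_max P y -> x = y.
Proof. by move=> [Px xm] [Py ym]; apply/eqP; rewrite eq_le ym // xm. Qed.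

Lemma max_or_inftyP d (T : orderType d) (P : set T) (x : T) :
  max_or_infty P = EFin x <-> is_max P x.
Proof.
rewrite /max_or_infty; case: pselect => [h|no]; last first.
  by split=> [|mx]; [case: asboolP|case: no; exists x].
case: cid => /= y my; split=> [[<-]//|mx]; congr EFin.
exact: is_max_uniq my mx.
Qed.

Section Lists.
Variables (n k : nat).
Implicit Types (D : {set edge n k}) (W P Q : seq (edge n k)) (x : edge n k).

(** A finite list that contains every path and every cycle, so that their weights and ratios have
    extrema. *)
Definition short_seqs : seq (seq (edge n k)) :=
  [seq val b | b <- enum {: n.-bseq (edge n k)}].

Lemma short_seqsP W : (size W <= n)%N -> W \in short_seqs.
Proof. by move=> sW; apply/mapP; exists (Bseq sW); rewrite ?mem_enum. Qed.

(** Walks can be replaced by paths, of which there are finitely many. The starting vertices S are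
    [A0] alone for distances and all the arcs for potentials; [h] separates the addition of weights
    in V from their comparison in T. *)
Lemma max_walk d (T : orderType d) (V : nmodType) (w : edge n k -> V)
    (h : V -> T) D (S : 'I_n -> Prop) v :
  (forall a b c : V, (h a <= h b)%O -> (h (a + c) <= h (b + c))%O) ->
  (forall W, is_cycle D W -> (h (weight w W) <= h 0)%O) ->
  (exists u W, S u /\ walk D u W v) ->
  exists u P, [/\ S u, is_path D u P v &
    forall u' W, S u' -> walk D u' W v -> (h (weight w W) <= h (weight w P))%O].
Proof.
move=> hD cyc [u0 [W0 [Su0 wW0]]].
pose le a b := (h a <= h b)%O.
have toP u W : walk D u W v -> exists2 P, is_path D u P v & le (weight w W) (weight w P).
  apply: (@path_weight_le _ _ _ _ le) => //.
  - by move=> x; rewrite /le.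
  - by move=> x y z; apply: le_trans.
pose Q := [set x | exists u P, [/\ S u, is_path D u P v & x = h (weight w P)]].
have [|x [u [P [Su pP ->]]]|x [[u [P [Su pP ->]]] xmax]] :=
  @finite_max _ _ Q [seq h (weight w W) | W <- short_seqs].
- by have [P0 pP0 _] := toP _ _ wW0; exists (h (weight w P0)), u0, P0.
- by apply: map_f; apply/short_seqsP/ltnW/(path_size pP).
exists u, P; split=> // u' W Su' /toP[P' pP' leP']; apply: le_trans leP' _.
by apply: xmax; exists u', P'.
Qed.
End Lists.

Lemma pair_addE (V V' : nmodType) (a c : V) (b d : V') :
  (a, b) + (c, d) = (a + c, b + d).
Proof. by []. Qed.

Lemma lexD (a b c : rat * int) :
  ((a : lexT) <= (b : lexT))%O -> ((a + c : lexT) <= (b + c : lexT))%O.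
Proof.
case: a b c => [a1 a2] [b1 b2] [c1 c2].
by rewrite !pair_addE !lexi_pair !lerD2r.
Qed.

(** * The separation weight refines the lexicographic weight *)

Section LexSep.
Variables (R : realType) (n k : nat) (M : arc_family R n).
Implicit Types (D : {set edge n k}) (W P Q : seq (edge n k)) (x : edge n k).

Definition noses W : nat := count (fun x => kind x != None) W.

Lemma noses_size W : (noses W <= size W)%N.
Proof. exact: count_size. Qed.

Lemma ext_size W : (absz (weight (@ext n k) W) <= size W)%N.
Proof.
elim: W => [|x W IH]; first by rewrite weight_nil.
rewrite weight_cons /=.
have : (absz (ext x) <= 1)%N by rewrite /ext; case: (kind x) => [?|]; case: ifP.
by lia.
Qed.

Lemma lexWE W : lexW M W =
  ((weight (@bal n k) W)%:~R + ratiok M k * (weight (@ext n k) W)%:~R,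
   weight (@ext n k) W).
Proof.
rewrite /lexW; elim: W => [|x W IH]; first by rewrite !weight_nil mulr0 addr0.
by rewrite !weight_cons IH /lex pair_addE !intrD; congr pair; ring.
Qed.

Lemma sepWE (c l : rat) W : weight (@sep n k c l) W =
  l * (weight (@bal n k) W)%:~R + c * (weight (@ext n k) W)%:~R + 2 * (noses W)%:R.
Proof.
elim: W => [|x W IH]; first by rewrite !weight_nil /noses /= !mulr0 !addr0.
rewrite !weight_cons IH !intrD /noses /= natrD /sep.
by case: (kind x) => [i|] /=; ring.
Qed.

Lemma cycle_ratios D W : is_cycle D W -> Defs.ratio W \in [seq Defs.ratio W | W <- short_seqs n k].
Proof. by move=> cW; apply/map_f/short_seqsP/(cycle_size cW). Qed.

Lemma ratiokP : (exists r, neg_ratios M k r) ->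
  is_max (neg_ratios M k) (ratiok M k).
Proof.
move=> ex; apply: (@xgetPex _ 0 [set r | is_max (neg_ratios M k) r]).
apply: (@finite_max _ _ _ [seq Defs.ratio W | W <- short_seqs n k]) => // x.
by case=> W [cW _ ->]; apply: cycle_ratios cW.
Qed.

Lemma ratiok0 : ~ (exists r, neg_ratios M k r) -> ratiok M k = 0.
Proof.
by move=> no; rewrite /ratiok xgetPN // => r [Pr _]; apply: no; exists r.
Qed.

Lemma RATIOkP : (exists r, pos_ratios M k r) ->
  exists2 r, is_min (pos_ratios M k) r & RATIOk M k = r%:E.
Proof.
move=> ex; rewrite /RATIOk; case: asboolP => [_|no]; last first.
  by case: ex => r Pr; case: no; exists r.
set P := [set r | is_min _ r]; have Px : P (xget 0 P).
  apply: xgetPex.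
  apply: (@finite_min _ _ _ [seq Defs.ratio W | W <- short_seqs n k]) => // x.
  by case=> W [cW _ ->]; apply: cycle_ratios cW.
by exists (xget 0 P).
Qed.

(** The maximum is attained by a cycle, whose at most n edges bound [ext]; in the absence of such
    cycles the default value is 0. *)
Lemma ratiok_den : (0 < n)%N -> exists (a : int) (b : nat),
  [/\ (0 < b)%N, (b <= n)%N & ratiok M k = a%:~R / b%:R].
Proof.
move=> n0; have [ex|no] := pselect (exists r, neg_ratios M k r); last first.
  by exists 0, 1%N; rewrite ratiok0 // mul0r.
have [[W [cW eW ->]] _] := ratiokP ex.
exists (weight (@bal n k) W), (absz (weight (@ext n k) W)).
split; [by lia|exact: leq_trans (ext_size W) (cycle_size cW)|].
rewrite /Defs.ratio; have -> : (weight (@ext n k) W) = - (absz (weight (@ext n k) W))%:Z.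
  by lia.
by rewrite abszN absz_nat rmorphN invrN mulrNN.
Qed.

(** The separation is l times the first coordinate, plus e times [ext], plus twice the number of
    noses. Different first coordinates differ by at least 1/n, and l/n = 64 n^2 outweighs the
    possible loss of 8 n^2 + 2 n in the other terms. If they agree, the gain e = 4n from [ext]
    outweighs a loss of 2n on the noses. *)
Lemma lex_sep_lt (e l c : rat) W1 W2 :
  e = (4 * n)%:R -> l = e ^+ 3 -> c = l * ratiok M k + e ->
  (0 < n)%N -> (size W1 <= n)%N -> (size W2 <= n)%N ->
  (lexW M W1 < lexW M W2)%O -> weight (@sep n k c l) W1 < weight (@sep n k c l) W2.
Proof.
move=> eE lE cE n0 s1 s2; rewrite !lexWE ltxi_pair !sepWE.
have [a [b [b0 bn rE]]] := ratiok_den n0.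
have [e1 e2] := (ext_size W1, ext_size W2).
have [m1 m2] := (noses_size W1, noses_size W2).
move: e1 e2 m1 m2; rewrite cE lE eE rE.
move: (weight _ W1) (weight _ W2) (weight _ W1) (weight _ W2) => B1 B2 E1 E2.
move: (noses W1) (noses W2) => N1 N2 e1 e2 m1 m2 H.
set r := a%:~R / b%:R in H *; set D := (B2 - B1)%:~R + r * (E2 - E1)%:~R.
have n1 : (1 : rat) <= n%:R by rewrite ler1n.
have dE : - (2 * n%:R) <= (E2 - E1)%:~R :> rat.
  have : (- (2 * n)%N%:Z)%:~R <= (E2 - E1)%:~R :> rat by rewrite ler_int; lia.
  by rewrite rmorphN /= -pmulrn natrM.
have mE : - n%:R <= N2%:R - N1%:R :> rat.
  have : N1%:R <= n%:R :> rat by rewrite ler_nat; lia.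
  by have : 0 <= N2%:R :> rat by []; lra.
suff : 0 < (4 * n)%:R ^+ 3 * D + (4 * n)%:R * (E2 - E1)%:~R + 2 * (N2%:R - N1%:R) :> rat.
  by rewrite /D !intrD !rmorphN /=; lra.
have b0' : (0 : rat) < b%:R by rewrite ltr0n.
(* Multiplied by b, the difference D is an integer; hence a positive D is at least 1/b. *)
have bD : b%:R * D = (b%:Z * (B2 - B1) + a * (E2 - E1))%:~R.
  rewrite /D /r !(intrD, intrM, rmorphN) /= -pmulrn; field; lra.
have bn' : b%:R <= n%:R :> rat by rewrite ler_nat.
have D01 : 1 <= n%:R * D \/ D = 0 /\ 1 <= (E2 - E1)%:~R :> rat.
  case/andP: H => D0 H; have {}D0 : 0 <= D by rewrite /D !intrD !rmorphN /=; lra.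
  move: D0; rewrite le_eqVlt => /orP[/eqP D0|D0]; [right|left].
    split=> //; rewrite ler1z; have : E1 < E2; last by lia.
    by apply: (implyP H); move: D0; rewrite /D !intrD !rmorphN /=; lra.
  have : 0 < b%:R * D by rewrite mulr_gt0.
  rewrite bD ltr0z gtz0_ge1 -(ler_int rat) -bD => bD1.
  by apply: le_trans bD1 _; rewrite ler_pM2r.
rewrite natrM; move: dE D01; move: ((E2 - E1)%:~R : rat) => dE dE1.
have n0' : 0 <= n%:R * n%:R :> rat by rewrite mulr_ge0.
case=> [nD|[-> dE2]]; last by nra.
have : n%:R * n%:R * 1 <= n%:R * n%:R * (n%:R * D) by rewrite ler_wpM2l.
have : n%:R * (- (2 * n%:R)) <= n%:R * dE by rewrite ler_wpM2l.
have : n%:R * 1 <= n%:R * n%:R :> rat by rewrite ler_wpM2l.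
by lra.
Qed.
End LexSep.

Lemma max_or_inftyN d (T : orderType d) (P : set T) x :
  P x -> max_or_infty P <> ENInf T.
Proof.
rewrite /max_or_infty => Px; case: pselect => [h|no] //.
by case: asboolP => // nP; case: nP; exists x.
Qed.

Lemma max_or_infty_ext d (T : orderType d) (P : set T) :
  max_or_infty P = ENInf T \/ exists x, P x.
Proof.
have [[x Px]|no] := pselect (exists x, P x); first by right; exists x.
left; rewrite /max_or_infty; case: pselect => [h|_].
  by case: no; case: h => x [Px _]; exists x.
by case: asboolP => // -[x Px]; case: no; exists x.
Qed.

(** * Redundant edges and distances from the initial arc *)

Section Dist.
Variables (R : realType) (n k : nat) (M : arc_family R n) (A0 : 'I_n).
Implicit Types (W P Q : seq (edge n k)) (x : edge n k).
Let S := Sgraph M k.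

Lemma lexW_cat W1 W2 : lexW M (W1 ++ W2) = (lexW M W1 : rat * int) + lexW M W2.
Proof. exact: weight_cat. Qed.

Lemma lexW_cons x W : lexW M (x :: W) = lex M x + lexW M W.
Proof. exact: weight_cons. Qed.

Lemma cycle_back D W x : is_cycle D W -> x \in W ->
  exists2 W', walk D (tgt x) W' (src x) & lex M x + lexW M W' = lexW M W.
Proof.
case=> _ [u /andP[wW _]] xW; case/splitPr: xW wW => W1 W2.
rewrite walk_cat /= => /and4P[w1 xD /eqP sx w2]; exists (W2 ++ W1).
  by rewrite walk_cat -(walk_endP w2) sx w2 w1.
by rewrite !lexW_cat lexW_cons addrA addrC.
Qed.

(** The edges of a cycle that is not lex-negative are not redundant: a walk to the target of such an
    edge can be continued around the cycle to its source and along the edge again without loss. *)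
Lemma acyclic_lex : acyclic (Rgraph M k A0) ->
  forall W, is_cycle S W -> (lexW M W < ((0, 0) : lexT))%O.
Proof.
move=> acyc W cW; rewrite ltNge; apply/negP => W0; apply: acyc; exists W.
have [W_ne [u /andP[wW uW]]] := cW; split=> //; exists u; rewrite uW andbT.
apply: walk_sub (wW) => x xW; rewrite inE (walk_subset wW xW) /=; apply/negP.
have [W' wW' EW'] := cycle_back cW xW.
have xS : x \in S := walk_subset wW xW.
rewrite /redundant /dist.
set Ps := [set _ | _]; set Pt := [set _ | _].
case E: (max_or_infty Ps) => [a||] //=.
- have /max_or_inftyP[[Q wQ Ea] amax] := E.
  have -> : max_or_infty Pt = EFin ((a : rat * int) + lex M x : lexT).
    apply/max_or_inftyP; split.
      exists (Q ++ [:: x]); last by rewrite lexW_cat lexW_cons /= -Ea /lexW weight_nil addr0.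
      by rewrite walk_cat -(walk_endP wQ) wQ /= xS !eqxx.
    move=> b [Q' wQ' Eb].
    have ba : (lexW M (Q' ++ W') <= a)%O.
      apply: amax; exists (Q' ++ W') => //.
      by rewrite walk_cat -(walk_endP wQ') wQ'.
    apply: (@le_trans _ _ ((b : rat * int) + lexW M W : lexT)).
      by have := lexD b W0; rewrite add0r addrC.
    have := lexD (lex M x) ba; rewrite lexW_cat -Eb.
    by rewrite -addrA (addrC (lexW M W' : rat * int)) EW'.
  by rewrite ltxx.
(* If no walk reaches the source then none reaches the target, from which the cycle leads to the
   source. *)
- case: (max_or_infty_ext Pt) => [->//|[b [Q wQ _]]] _.
  by have := @max_or_inftyN _ _ Ps _ _ E; apply; exists (Q ++ W') => //;
     rewrite walk_cat -(walk_endP wQ) wQ.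
Qed.

Hypothesis lex_neg : forall W, is_cycle S W -> (lexW M W < ((0, 0) : lexT))%O.
Hypothesis reach : forall v, exists W, walk S A0 W v.

Lemma lex_dist v : exists P,
  [/\ is_path S A0 P v, dist (@lexW R n M k) S A0 v = EFin (lexW M P) &
      forall W, walk S A0 W v -> (lexW M W <= lexW M P)%O].
Proof.
have [|||u [P [-> pP Pmax]]] :=
  @max_walk n k _ lexT _ (@lex R n M k) id S (fun u => u = A0) v.
- by move=> a b c; apply: lexD.
- by move=> W /lex_neg/ltW.
- by have [W wW] := reach v; exists A0, W.
exists P; split=> //; last by move=> W; apply: Pmax.
apply/max_or_inftyP; split; first by exists P => //; apply: path_walk pP.
by move=> _ [W wW ->]; apply: Pmax.
Qed.

(** Along a non-redundant edge the distance from [A0] grows by at most the weight of the edge;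
    around a cycle this would give a weight of at least (0, 0). *)
Lemma lex_acyclic : acyclic (Rgraph M k A0).
Proof.
case=> W cW; have [_ [u /andP[wW uW]]] := cW.
pose d v := lexW M (sval (cid (lex_dist v))) : rat * int.
have dE v : dist (@lexW R n M k) S A0 v = EFin (d v : lexT).
  by rewrite /d; case: cid => P [].
have step v W1 w : walk (Rgraph M k A0) v W1 w ->
    ((d w : lexT) <= d v + lexW M W1)%O.
  elim: W1 v => [|x W1 IH] v /=; first by move/eqP->; rewrite /lexW weight_nil addr0.
  case/and3P; rewrite inE => /andP[_]; rewrite /redundant !dE /= -leNgt => nr.
  move=> /eqP <- /IH /le_trans-> //.
  by rewrite lexW_cons addrA; apply: lexD.
have := lexD (- d u) (step _ _ _ wW); rewrite subrr [d u + _]addrC addrK.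
rewrite leNgt => /negP; apply; apply: lex_neg.
have sub : {subset Rgraph M k A0 <= S} by move=> x; rewrite inE => /andP[].
split; first by case: cW.
by exists u; rewrite uW andbT; apply: walk_sub (wW) => x /(walk_subset wW)/sub.
Qed.

Variables (e l c : rat).
Hypothesis eE : e = (4 * n)%:R.
Hypothesis lE : l = e ^+ 3.
Hypothesis cE : c = l * ratiok M k + e.

Lemma sep_neg W : is_cycle S W -> weight (@sep n k c l) W < 0.
Proof.
move=> cW; rewrite -(weight_nil (@sep n k c l)).
apply: (lex_sep_lt eE lE cE) => //; [by case: (n) A0 => [[]|]|exact: cycle_size cW|].
by rewrite [X in (_ < X)%O]/lexW weight_nil; apply: lex_neg.
Qed.

(** A longest path for [sep] has no redundant edge: up to the target of such an edge it is
    lexicographically below some other path, which has a larger [sep] by [lex_sep_lt] and could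
    replace it. *)
Lemma sep_dist v : exists x : rat,
  dist (weight (@sep n k c l)) S A0 v = x%:E /\
  path_dist (weight (@sep n k c l)) (Rgraph M k A0) A0 v = x%:E.
Proof.
have n0 : (0 < n)%N by case: (n) A0 => [[]|].
have [|||u [P [-> pP Pmax]]] :=
  @max_walk n k _ rat _ (@sep n k c l) id S (fun u => u = A0) v.
- by move=> a b c'; rewrite lerD2r.
- by move=> W /sep_neg/ltW.
- by have [W wW] := reach v; exists A0, W.
have sub : {subset Rgraph M k A0 <= S} by move=> x; rewrite inE => /andP[].
exists (weight (@sep n k c l) P); split; apply/max_or_inftyP; split.
- by exists P => //; apply: path_walk pP.
- by move=> _ [W wW ->]; apply: Pmax.
- exists P => //; have /andP[wP uP] := pP; rewrite /is_path uP andbT.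
  apply: walk_sub (wP) => x xP; rewrite inE (walk_subset wP xP) /=.
  apply/negP; case/splitPr: xP pP wP Pmax {uP} => P1 P2 pP wP Pmax.
  move: wP; rewrite walk_cat /= => /and4P[w1 xS /eqP sx w2].
  have [Q [pQ dQ Qmax]] := lex_dist (tgt x).
  have [Q' [pQ' dQ' Qmax']] := lex_dist (src x).
  rewrite /redundant dQ dQ' /= => lt.
  have {}lt : (lexW M (P1 ++ [:: x]) < lexW M Q)%O.
    apply: le_lt_trans lt; rewrite lexW_cat lexW_cons /lexW weight_nil addr0.
    by apply/lexD/Qmax'; rewrite sx.
  have sP1 : (size (P1 ++ [:: x]) <= n)%N.
    move: pP; rewrite -cat_rcons -cats1 => /path_catl/path_size.
    exact: ltnW.
  have := lex_sep_lt eE lE cE n0 sP1 (ltnW (path_size pQ)) lt.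
  have : walk S A0 (Q ++ P2) v by rewrite walk_cat -(walk_endP (path_walk pQ)) path_walk.
  move=> /(Pmax _ _ erefl); rewrite -cat_rcons -cats1 !weight_cat.
  by rewrite lerD2r => /le_lt_trans h /h; rewrite ltxx.
- move=> _ [W /path_walk wW ->]; apply: Pmax => //.
  by apply: walk_sub (wW) => x /(walk_subset wW)/sub.
Qed.

End Dist.

(** * Lifting the arcs to the line *)

Section Residues.
Variables (n : nat) (A0 : 'I_n).

(* The arc whose lifts include x; A0 is only the default value of insubd. *)
Definition cl (x : int) : 'I_n := insubd A0 (absz (x %% n%:Z)%Z).

Lemma ord_gt0 : (0 < n)%N.
Proof. by case: (n) A0 => [[]|]. Qed.

Lemma val_cl x : (cl x : nat)%:Z = (x %% n%:Z)%Z.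
Proof.
have n0 := ord_gt0; have n1 : n%:Z != 0 by lia.
rewrite /cl val_insubd; have := modz_ge0 x n1; have := ltz_pmod x (_ : 0 < n%:Z).
by move=> /(_ ltac:(lia)); move: (x %% _)%Z => r; case: ifP; lia.
Qed.

Lemma cl_uniq (i : 'I_n) x q : x = (i : nat)%:Z + n%:Z * q -> cl x = i.
Proof.
move=> ->; apply: val_inj; apply/eqP; rewrite -eqz_nat; apply/eqP.
by rewrite val_cl addrC mulrC modzMDl modz_small //; have := ltn_ord i; lia.
Qed.

Lemma cl_idx (i : 'I_n) : cl (i : nat) = i.
Proof. by apply: (@cl_uniq _ _ 0); rewrite mulr0 addr0. Qed.

Lemma cl_decomp x : x = (cl x : nat)%:Z + n%:Z * (x %/ n%:Z)%Z.
Proof. by rewrite val_cl addrC mulrC -divz_eq. Qed.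

Lemma cl_per x q : cl (x + n%:Z * q) = cl x.
Proof.
apply: (@cl_uniq _ _ ((x %/ n%:Z)%Z + q)).
by rewrite {1}(cl_decomp x); ring.
Qed.

Lemma cl_per1 x : cl (x + n%:Z) = cl x.
Proof. by rewrite -[n%:Z]mulr1 cl_per. Qed.

Lemma cl_eq x y : cl x = cl y -> exists q, x = y + n%:Z * q.
Proof.
move=> E; exists ((x %/ n%:Z)%Z - (y %/ n%:Z)%Z).
have := cl_decomp x; have := cl_decomp y; rewrite E mulrBr.
by move: (_ * _) (_ * _) => a b; lia.
Qed.

Lemma cl_inj x y : cl x = cl y -> x < y + n%:Z -> y < x + n%:Z -> x = y.
Proof.
move=> /cl_eq[q ->]; have := ord_gt0.
case: (ltrgtP q 0) => [q0|q0|->]; rewrite ?mulr0 ?addr0 //.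
  have : n%:Z * q <= n%:Z * -1 by rewrite ler_wpM2l //; lia.
  lia.
have : n%:Z * 1 <= n%:Z * q by rewrite ler_wpM2l //; lia.
lia.
Qed.

Lemma cl_lift (A : 'I_n) (x : int) : exists y, [/\ cl y = A, x <= y & y < x + n%:Z].
Proof.
have n1 : n%:Z != 0 by have := ord_gt0; lia.
have := divz_eq (A%:Z - x) n%:Z; have := modz_ge0 (A%:Z - x) n1.
have := ltz_pmod (A%:Z - x) (_ : 0 < n%:Z) => /(_ ltac:(have := ord_gt0; lia)).
move: (_ %% _)%Z (_ %/ _)%Z => r q r1 r2 E; exists (x + r); split; [|lia|lia].
by apply: (@cl_uniq _ _ (- q)); rewrite mulrN mulrC; lia.
Qed.

Lemma quo_per x : ((x + n%:Z) %/ n%:Z)%Z = (x %/ n%:Z)%Z + 1.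
Proof.
by rewrite addrC -{1}[n%:Z]mul1r divzMDl; [rewrite addrC|have := ord_gt0; lia].
Qed.

Lemma quo_mono x y : x <= y -> (x %/ n%:Z)%Z <= (y %/ n%:Z)%Z.
Proof.
have n0 : 0 < n%:Z by have := ord_gt0; lia.
by move=> xy; rewrite lez_divRL // (le_trans _ xy) // -lez_divRL.
Qed.

Lemma Ra_cl x : Ra (cl x) = cl (x + 1).
Proof.
apply/esym; have lt := ltn_ord (cl x); have Ex := cl_decomp x.
have [E|ne] := eqVneq (cl x : nat).+1 n.
  apply: (@cl_uniq _ _ ((x %/ n%:Z)%Z + 1)).
  rewrite {1}Ex /= E modnn mulrDr mulr1; move: (_ * _) => a; lia.
apply: (@cl_uniq _ _ (x %/ n%:Z)%Z); rewrite {1}Ex /= modn_small; last lia.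
by rewrite -addn1 PoszD; ring.
Qed.

Lemma La_cl x : La (cl x) = cl (x - 1).
Proof. by rewrite -{1}[x](subrK 1) -Ra_cl /La /Ra ordSK. Qed.

Lemma iter_Ra_cl j x : iter j (@Ra n) (cl x) = cl (x + j%:Z).
Proof.
elim: j => [|j IH]; first by rewrite addr0.
by rewrite iterS IH Ra_cl -addrA -PoszD addn1.
Qed.

Lemma iter_La_cl j x : iter j (@La n) (cl x) = cl (x - j%:Z).
Proof.
elim: j => [|j IH]; first by rewrite subr0.
by rewrite iterS IH La_cl -addrA -opprD -PoszD addn1.
Qed.

Lemma farthestE (step : 'I_n -> 'I_n) (P : pred 'I_n) A d : (d < n)%N ->
  (forall j, (j < n)%N -> P (iter j step A) = (j <= d)%N) ->
  farthest step P A = iter d step A.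
Proof.
move=> dn H; congr (iter _ _ _); apply/eqP; rewrite eqn_leq; apply/andP; split.
  apply/bigmax_leqP => m /forallP/(_ m); rewrite leqnn H // => //.
apply: (@leq_bigmax_cond _ _ (fun m : 'I_n => m : nat) (Ordinal dn)).
by apply/forallP => j; apply/implyP => /= jd; rewrite H.
Qed.
End Residues.

(** * Points of the circle and their lifts *)

Section Circle.
Variables (R : realType) (C : R).
Hypothesis C_gt0 : 0 < C.

Lemma circle_quo (m : int) (a b : R) : 0 <= a < C -> 0 <= b < C ->
  a = b + C * m%:~R -> m = 0.
Proof.
move=> ha hb E; apply/eqP; case: ltgtP => // m0.
  have : m%:~R <= -1 :> R by rewrite -[-1]/((-1)%:~R) ler_int; lia.
  by have := C_gt0; nra.
have : 1 <= m%:~R :> R by rewrite -[1]/(1%:~R) ler_int; lia.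
by have := C_gt0; nra.
Qed.

Lemma circle_quo01 (s t : R) (a b : int) : 0 <= s < C -> 0 <= t < C ->
  s + C * a%:~R <= t + C * b%:~R -> t + C * b%:~R < s + C * a%:~R + C ->
  b = a \/ b = a + 1.
Proof.
move=> /andP[s0 sC] /andP[t0 tC] le lt.
have : ((a - 1)%:~R < b%:~R :> R) /\ (b%:~R < (a + 2)%:~R :> R).
  by rewrite rmorphB rmorphD /= -![_%:~R]/(_%:~R); split; nra.
by rewrite !ltr_int; lia.
Qed.

Lemma circle_congr (a b x : R) (m : int) : a = b + C * m%:~R ->
  x <= a -> a < x + C -> x <= b -> b < x + C -> a = b.
Proof.
move=> E a1 a2 b1 b2; have := @circle_quo m (a - x) (b - x).
by rewrite E => H; rewrite H ?mulr0 ?addr0 //; lra.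
Qed.

Lemma in_arc_lift (s t q S T P : R) (a b m : int) :
  0 <= s < C -> 0 <= t < C -> 0 <= q < C ->
  S = s + C * a%:~R -> T = t + C * b%:~R -> P = q + C * m%:~R ->
  S < T -> T < S + C -> S <= P -> P < S + C ->
  in_arc s t q = (P < T) && (S < P).
Proof.
move=> hs ht hq -> -> -> ST TS SP PS.
have hb := circle_quo01 hs ht (ltW ST) TS; have hm := circle_quo01 hs hq SP PS.
move: hs ht hq => /andP[s0 sC] /andP[t0 tC] /andP[q0 qC].
rewrite /in_arc; move: ST TS SP PS.
case: hb => ->; case: hm => ->; rewrite ?mulrzDr; move: (_%:~R : R) => a';
 case: (ltrP s t) => st ST TS SP PS; try lra.
Qed.

End Circle.

(** * Lifts of the extremes, of F_r and of F_l *)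

Section Lift.
Variables (R : realType) (n : nat) (M : arc_family R n) (A0 : 'I_n).
Hypothesis hM : is_pca M.
Let C := clen M.
Let cl := cl A0.

Definition lift_beg (x : int) : R := abeg M (cl x) + C * (x %/ n%:Z)%Z%:~R.

(** An external arc ends in the turn after the one in which it begins. *)
Definition lift_end (x : int) : R :=
  aend M (cl x) + C * ((x %/ n%:Z)%Z + external M (cl x))%:~R.

Let S := lift_beg.
Let T := lift_end.

Let C_gt0 : 0 < C. Proof. by case: hM. Qed.

Lemma lift_beg_per1 x : S (x + n%:Z) = S x + C.
Proof.
by rewrite /S /lift_beg /cl cl_per1 (quo_per A0) mulrzDr mulrDr mulr1 addrA.
Qed.

Lemma lift_end_per1 x : T (x + n%:Z) = T x + C.
Proof.
by rewrite /T /lift_end /cl cl_per1 (quo_per A0) -/C !mulrzDr; ring.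
Qed.

Lemma lift_beg_mono : {homo S : x y / x < y}.
Proof.
move=> x y xy; have [_ bnd _ mono _] := hM; rewrite /S /lift_beg.
have [dx dy] := (cl_decomp A0 x, cl_decomp A0 y); rewrite -/cl in dx dy.
have bx := bnd false (cl x); have b_y := bnd false (cl y); rewrite /= in bx b_y.
have : (x %/ n%:Z)%Z <= (y %/ n%:Z)%Z by apply: (quo_mono A0); lia.
rewrite le_eqVlt => /orP[/eqP E|lt].
  by rewrite E ltrD2r mono // -ltz_nat; move: dx dy; rewrite E; lia.
have : ((x %/ n%:Z)%Z + 1)%:~R <= (y %/ n%:Z)%Z%:~R :> R by rewrite ler_int; lia.
rewrite mulrzDr => /(ler_wpM2l (ltW C_gt0)).
by rewrite mulrDr mulr1 -/C in bx b_y *; lra.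
Qed.

Lemma lift_beg_le x y : (S x <= S y) = (x <= y).
Proof. exact: (le_mono lift_beg_mono). Qed.

Lemma lift_beg_lt x y : (S x < S y) = (x < y).
Proof. exact: (leW_mono lift_beg_le). Qed.

Lemma lift_beg_perz x q : S (x + n%:Z * q) = S x + C *~ q.
Proof. by rewrite (per_mulz lift_beg_per1). Qed.

Lemma abeg_neq_aend A B : abeg M A != aend M B.
Proof.
by have [_ _ inj _ _] := hM; apply/eqP => /(inj false true A B).
Qed.

Lemma lift_beg_lt_end x : S x < T x.
Proof.
have [_ bnd _ _ _] := hM; rewrite /S /T /lift_beg /lift_end.
have := bnd false (cl x); have := bnd true (cl x); rewrite /= /external mulrzDr -/C.
have := abeg_neq_aend (cl x) (cl x).
by move: (_%:~R : R) => a; case: (ltgtP (abeg _ _) (aend _ _)) => //= E _ /andP[? ?] /andP[? ?];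
   rewrite ?mulr1z ?mulr0z; nra.
Qed.

Lemma lift_end_lt_beg x : T x < S x + C.
Proof.
have [_ bnd _ _ _] := hM; rewrite /S /T /lift_beg /lift_end.
have := bnd false (cl x); have := bnd true (cl x); rewrite /= /external mulrzDr -/C.
have := abeg_neq_aend (cl x) (cl x).
by move: (_%:~R : R) => a; case: (ltgtP (abeg _ _) (aend _ _)) => //= E _ /andP[? ?] /andP[? ?];
   rewrite ?mulr1z ?mulr0z; nra.
Qed.

Lemma lift_beg_neq_end x y : S x != T y.
Proof.
have [_ bnd _ _ _] := hM; apply/eqP; rewrite /S /T /lift_beg /lift_end => E.
have := @circle_quo _ _ C_gt0 ((y %/ n%:Z)%Z + external M (cl y) - (x %/ n%:Z)%Z) _ _
  (bnd false (cl x)) (bnd true (cl y)).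
rewrite rmorphB /= mulrBr => H; case/eqP: (abeg_neq_aend (cl x) (cl y)).
have m0 := H ltac:(lra); move: E.
have -> : ((y %/ n%:Z)%Z + external M (cl y) = (x %/ n%:Z)%Z) by lia.
by lra.
Qed.

Lemma in_arcE x (P q : R) (m : int) : S x <= P -> P < S x + C -> 0 <= q < C ->
  q = P - C * m%:~R -> in_arc (abeg M (cl x)) (aend M (cl x)) q = (P < T x) && (S x < P).
Proof.
have [_ bnd _ _ _] := hM; move=> SP PS hq E.
apply: (in_arc_lift C_gt0 (bnd false _) (bnd true _) hq erefl erefl _ _ _ SP PS (m := m)).
- by rewrite E subrK.
- exact: lift_beg_lt_end.
- exact: lift_end_lt_beg.
Qed.

Lemma lift_point (x : int) (q : R) : 0 <= q < C ->
  exists (P : R) (m : int), [/\ S x <= P, P < S x + C & q = P - C * m%:~R].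
Proof.
move=> /andP[q0 qC]; have c0 := C_gt0.
have [_ bnd _ _ _] := hM; have /andP[s0 sC] := bnd false (cl x).
rewrite /S /lift_beg -/C /= in s0 sC *.
move: (abeg _ _) s0 sC => s s0 sC; set a := (x %/ _)%Z.
have [sq|qs] := leP s q.
  by exists (q + C * a%:~R), a; split; lra.
exists (q + C * (a + 1)%:~R), (a + 1); rewrite mulrzDr; split; lra.
Qed.

(** If y begins after x, by less than a turn, and does not end after x, then it is contained in x,
    against the absence of inclusions. *)
Lemma lift_end_mono : {homo T : x y / x < y}.
Proof.
move=> x y xy; have [_ _ _ _ incl] := hM.
have [ge|lt] := lerP (x + n%:Z) y.
  apply: lt_trans (lift_beg_lt_end y); apply: lt_le_trans (lift_end_lt_beg x) _.
  by rewrite -lift_beg_per1 lift_beg_le.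
rewrite ltNge; apply/negP => TT.
have : cl y = cl x.
  apply: incl => q [hq]; have [P [m [P1 P2 E]]] := lift_point y hq.
  rewrite (in_arcE P1 P2 hq E) => /andP[PT SP]; split=> //.
  have Sxy : S x < S y by rewrite lift_beg_lt.
  have := lift_end_lt_beg x => TS.
  rewrite (@in_arcE x P q m) //; [|lra|lra].
  by apply/andP; split; lra.
by move=> /cl_inj; lia.
Qed.

Lemma lift_end_le x y : (T x <= T y) = (x <= y).
Proof. exact: (le_mono lift_end_mono). Qed.

Lemma lift_end_lt x y : (T x < T y) = (x < y).
Proof. exact: (leW_mono lift_end_le). Qed.

(* The lift of F_r, and its lower adjoint, which lifts F_l. *)
Definition fwd (x : int) : int := x + (\max_(j < n | (S (x + j%:Z) < T x)%R) j)%N%:Z.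

Definition bwd (x : int) : int := x - (\max_(j < n | (x <= fwd (x - j%:Z))%R) j)%N%:Z.

Lemma fwdE x y : (y <= fwd x) = (S y < T x).
Proof.
pose P := [pred j : 'I_n | S (x + j%:Z) < T x].
have -> : fwd x = x + (\max_(j < n | P j) j)%N%:Z by [].
have [j Pj Ej] : exists2 j : 'I_n, P j & \max_(j < n | P j) j = j.
  have P0 : P (Ordinal (ord_gt0 A0)) by rewrite /= addr0 lift_beg_lt_end.
  by have [|j] := @eq_bigmax_cond _ P (fun j => j : nat); [apply/card_gt0P; exists (Ordinal (ord_gt0 A0))|exists j].
apply/idP/idP => [yx|yx].
  apply: le_lt_trans Pj; rewrite lift_beg_le; move: yx; rewrite Ej; lia.
rewrite leNgt; apply/negP => xy.
(* Arcs are shorter than a turn, so the offsets below n inspected by [fwd] are enough. *)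
have yn : y < x + n%:Z.
  by rewrite -lift_beg_lt lift_beg_per1 (lt_trans yx) // lift_end_lt_beg.
have yn' : (absz (y - x)%R < n)%N by lia.
suff : (absz (y - x)%R <= \max_(j < n | P j) j)%N by lia.
apply: (@leq_bigmax_cond _ P (fun j : 'I_n => j : nat) (Ordinal yn')).
by rewrite /= (_ : x + _ = y) //; lia.
Qed.

Lemma fwd_ge x : x <= fwd x.
Proof. by rewrite fwdE lift_beg_lt_end. Qed.

Lemma fwd_lt x : fwd x < x + n%:Z.
Proof. by rewrite ltNge fwdE -leNgt lift_beg_per1 ltW // lift_end_lt_beg. Qed.

Lemma fwd_per x : fwd (x + n%:Z) = fwd x + n%:Z.
Proof.
have H y : (y <= fwd (x + n%:Z)) = (y <= fwd x + n%:Z).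
  rewrite fwdE lift_end_per1 -[y in LHS](subrK n%:Z) lift_beg_per1 ltrD2r.
  by rewrite -fwdE lerBlDr.
by apply/eqP; rewrite eq_le -H lexx H lexx.
Qed.

Lemma fwd_mono x y : x <= y -> fwd x <= fwd y.
Proof.
move=> xy; rewrite fwdE; apply: lt_le_trans (_ : T x <= T y); last by rewrite lift_end_le.
by rewrite -fwdE.
Qed.

Lemma bwdE x y : (x <= fwd y) = (bwd x <= y).
Proof.
pose P := [pred j : 'I_n | x <= fwd (x - j%:Z)].
have -> : bwd x = x - (\max_(j < n | P j) j)%N%:Z by [].
have [j Pj Ej] : exists2 j : 'I_n, P j & \max_(j < n | P j) j = j.
  have P0 : P (Ordinal (ord_gt0 A0)) by rewrite /= subr0 fwd_ge.
  by have [|j] := @eq_bigmax_cond _ P (fun j => j : nat); [apply/card_gt0P; exists (Ordinal (ord_gt0 A0))|exists j].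
apply/idP/idP => [yx|yx]; last first.
  by apply: le_trans Pj (fwd_mono _); move: yx; rewrite Ej; lia.
have [|yx'] := lerP x y; first lia.
have yn : x < y + n%:Z by apply: le_lt_trans yx (fwd_lt y).
have yn' : (absz (x - y)%R < n)%N by lia.
suff : (absz (x - y)%R <= \max_(j < n | P j) j)%N by lia.
apply: (@leq_bigmax_cond _ P (fun j : 'I_n => j : nat) (Ordinal yn')).
by rewrite /= (_ : x - _ = y) //; lia.
Qed.

Lemma fwd_bwd : circle_map n fwd bwd.
Proof. split; [exact: bwdE|exact: fwd_per|exact: fwd_ge]. Qed.

Lemma bwd_gt x : x - n%:Z < bwd x.
Proof.
rewrite ltNge -bwdE -ltNge; have := fwd_lt (x - n%:Z); lia.
Qed.

Lemma abeg_in_arc x (j : nat) : (j < n)%N ->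
  in_arc (abeg M (cl x)) (aend M (cl x)) (abeg M (cl (x + j%:Z))) =
  (0 < j)%N && (x + j%:Z <= fwd x).
Proof.
move=> jn; have [_ bnd _ _ _] := hM.
rewrite (@in_arcE x (S (x + j%:Z)) _ ((x + j%:Z) %/ n%:Z)%Z).
- by rewrite fwdE lift_beg_lt andbC; congr (_ && _); lia.
- by rewrite lift_beg_le; lia.
- by rewrite -lift_beg_per1 lift_beg_lt; lia.
- exact: (bnd false).
- by rewrite /S /lift_beg -/C; lra.
Qed.

Lemma Fr_cl x : Fr M (cl x) = cl (fwd x).
Proof.
have f1 := fwd_ge x; have f2 := fwd_lt x.
rewrite /Fr (@farthestE _ _ _ _ (absz (fwd x - x)%R)) ?iter_Ra_cl; first last.
- move=> j jn; rewrite iter_Ra_cl abeg_in_arc //.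
  case: j jn => [|j] jn; first by rewrite /= addr0 eqxx; lia.
  rewrite (_ : _ == _ = false) ?orbF /=; first lia.
  apply/eqP => E; have [_ _ inj _ _] := hM.
  by have [/cl_inj] := inj false false _ _ E; lia.
- lia.
by congr cl; lia.
Qed.

Lemma Fl_cl x : Fl M (cl x) = cl (bwd x).
Proof.
have f1 := cm_adj_le fwd_bwd x; have f2 := bwd_gt x.
rewrite /Fl (@farthestE _ _ _ _ (absz (x - bwd x)%R)) ?iter_La_cl; first last.
- move=> j jn; rewrite iter_La_cl; have [_ bnd inj _ _] := hM.
  case: j jn => [|j] jn; first by rewrite /= subr0 eqxx orbT; lia.
  rewrite (_ : _ == _ = false) ?orbF /=; last first.
    apply/eqP => E; have [/cl_inj] := inj true true _ _ E; lia.
  rewrite (_ : (j.+1 <= _)%N = (x <= fwd (x - j.+1%:Z))); last by rewrite bwdE; lia.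
  rewrite fwdE; set y := x - j.+1%:Z.
  have yn : T x < T (y + n%:Z) by rewrite lift_end_lt /y; lia.
  have yx : T y < T x by rewrite lift_end_lt /y; lia.
  have Ty q : T (y + n%:Z * q) = T y + C *~ q by rewrite (per_mulz lift_end_per1).
  have nE := lift_beg_neq_end x y; have xs := lift_end_lt_beg x.
  rewrite lift_end_per1 in yn.
  (* In the turn starting at [S x] the end of y is represented by [T y] or by [T y + C]; in the
     second case it lies beyond [T x]. *)
  case: (ltgtP (S x) (T y)) nE => // lt _.
    rewrite (@in_arcE x (T y) _ ((y %/ n%:Z)%Z + external M (cl y))) ?yx ?lt //.
    - exact: ltW.
    - by apply: lt_trans yx _.
    - exact: (bnd true).
    - by rewrite /T /lift_end -/C; lra.
  rewrite (@in_arcE x (T y + C) _ ((y %/ n%:Z)%Z + external M (cl y) + 1)).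
  - by rewrite ltNge (ltW yn).
  - by have := lift_beg_lt_end x; lra.
  - by lra.
  - exact: (bnd true).
  - by rewrite /T /lift_end -/C [in RHS]mulrzDr; lra.
- lia.
by congr cl; lia.
Qed.

End Lift.

(** * Powers *)

Lemma finite_lower (F : realFieldType) (I : finType) (h : I -> F) :
  (forall i, 0 < h i) -> exists2 d : F, 0 < d & forall i, d < h i.
Proof.
move=> h0; suff [d d0 dh] : exists2 d : F, 0 < d & forall i, i \in enum I -> d < h i.
  by exists d => // i; apply: dh; rewrite mem_enum.
elim: (enum I) => [|i s [d d0 dh]]; first by exists 1.
exists (Num.min d (h i) / 2).
  by rewrite divr_gt0 // lt_min d0 h0.
have m0 : 0 < Num.min d (h i) by rewrite lt_min d0 h0.
move=> j; rewrite inE => /orP[/eqP ->|/dh dj].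
  have : Num.min d (h i) <= h i by rewrite ge_min lexx orbT.
  lra.
have : Num.min d (h i) <= d by rewrite ge_min lexx.
lra.
Qed.

Section Power.
Variables (R : realType) (n : nat) (M : arc_family R n) (A0 : 'I_n).
Hypothesis hM : is_pca M.

Lemma small_eps_ex j : exists e, small_eps M j e.
Proof.
have [C0 bnd _ _ _] := hM; have n0 := ord_gt0 A0.
pose h (i : 'I_n * bool * 'I_n) : R := let: (A, b, B) := i in
  if abeg M A < extreme M b B then extreme M b B - abeg M A else clen M - abeg M A.
pose h' (A : 'I_n) : R := clen M - abeg M A.
have [|d d0 dh] := @finite_lower _ _ h.
  move=> [[A b] B]; rewrite /h; case: ifP => [|_]; first by rewrite subr_gt0.
  by rewrite subr_gt0; case/andP: (bnd false A).
have [|d' d'0 dh'] := @finite_lower _ _ h'.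
  by move=> A; rewrite /h' subr_gt0; case/andP: (bnd false A).
have nR : 0 < n%:R :> R by rewrite ltr0n.
set m := Num.min (Num.min d d') 1.
have m0 : 0 < m by rewrite !lt_min d0 d'0 ltr01.
have [md md'] : m <= d /\ m <= d' by rewrite !ge_min !lexx ?orbT.
have m1 : m <= 1 by rewrite ge_min lexx orbT.
(* Ranks are at most n, so all the offsets are at most m, which is below every distance from a
   beginning point to a later extreme and to the end of the circle; m <= 1 gives the bound 1/n. *)
exists (m / (n%:R + 1)); split.
  rewrite divr_gt0 //=; last lra.
  rewrite ltr_pdivrMr; last lra.
  have nV : 0 < n%:R^-1 :> R by rewrite invr_gt0.
  by rewrite mulrDr mulVf ?mulr1; lra.
move=> A; set Z := iter j (Fr M) A.
have le : m / (n%:R + 1) * (pow_rank M j A).+1%:R <= m.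
  rewrite mulrAC ler_pdivrMr; last lra.
  rewrite ler_wpM2l ?(ltW m0) // natr1 ler_nat ltnS.
  by rewrite -[X in (_ <= X)%N]card_ord max_card.
split; first by have := dh' Z; rewrite /h' /pow_end -/Z; lra.
move=> b B /andP[lt]; rewrite /pow_end -/Z leNgt => /negP; apply.
by have := dh (Z, b, B); rewrite /h lt; lra.
Qed.

Lemma power_end j A : let Z := iter j (Fr M) A in let t := aend (power M j) A in
  [/\ abeg M Z < t, t < clen M, 
      forall b B, (extreme M b B <= t) = (extreme M b B <= abeg M Z) &
      forall A', (iter j (Fr M) A' = Z) ->
        (t < aend (power M j) A') = (pow_rank M j A < pow_rank M j A')%N].
Proof.
move=> Z t; rewrite /t /=; have := xgetPex 0 (small_eps_ex j).
set e := xget _ _ => -[/andP[e0 _] H]; have [tC no] := H A.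
have lt : abeg M Z < pow_end M j e A.
  by rewrite /pow_end -/Z ltrDl mulr_gt0.
split=> // [b B|A' EA'].
  apply/idP/idP => [le|le]; last exact: le_trans le (ltW lt).
  by rewrite leNgt; apply/negP => lt'; apply: (no b B); rewrite lt'.
by rewrite /pow_end EA' -/Z ltrD2l ltr_pM2l // ltr_nat.
Qed.

Lemma power_beg_lt j A B :
  (abeg M B < aend (power M j) A) = (B <= iter j (Fr M) A)%N.
Proof.
have [lt _ spec _] := power_end j A; have [_ _ _ mono _] := hM.
have [le|gt] := leqP B (iter j (Fr M) A).
  apply: le_lt_trans lt; move: le; rewrite leq_eqVlt => /orP[/eqP/val_inj ->|/mono/ltW] //.
have := spec false B; rewrite /= => E; apply/negbTE.
rewrite -leNgt ltW // ltNge E -ltNge; exact: mono.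
Qed.

Lemma power_lt_beg j A B :
  (aend (power M j) A < abeg M B) = (iter j (Fr M) A < B)%N.
Proof.
have [lt _ spec _] := power_end j A; have [_ _ _ mono _] := hM.
have [le|gt] := leqP B (iter j (Fr M) A).
  by apply/negbTE; rewrite -leNgt ltW // power_beg_lt.
by have := spec false B; rewrite /= => E; rewrite ltNge E -ltNge; apply: mono.
Qed.

Let cl := cl A0.
Let f := fwd M A0.
Let g := bwd M A0.
Let fg : circle_map n f g := fwd_bwd A0 hM.

Lemma iter_Fr_cl j x : iter j (Fr M) (cl x) = cl (iter j f x).
Proof. by elim: j => //= j ->; rewrite Fr_cl. Qed.

Lemma lift_iter j A z : iter j (Fr M) A = cl z -> exists2 x, cl x = A & iter j f x = z.
Proof.
rewrite -{1}(cl_idx A0 A) iter_Fr_cl => /cl_eq[q E].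
exists ((A : nat)%:Z + n%:Z * - q); first by rewrite /cl cl_per cl_idx.
by rewrite (per_mulz (iter_cm_per fg j)) E mulrzz mulrN addrK.
Qed.

Section Rank.
Variables (j : nat).
Hypothesis short : forall x, iter j f x < x + n%:Z.

(** The beginning points met by b, f(b), ..., f^(j-1)(b) are those with index after b and up to
    f^j(b). As f^j gains less than a turn, x is the only lift of its arc that can occur among
    them. *)
Lemma rank_mem b x : iter j f b = iter j f x ->
  [exists i : 'I_j, let X := iter i (Fr M) (cl b) in
     in_arc (abeg M X) (aend M X) (abeg M (cl x))] = (b < x).
Proof.
move=> E; have [xz bz] := (short x, short b).
have lexz := iter_cm_ge fg j x.
apply/existsP/idP => [[i]|bx].
  rewrite /= iter_Fr_cl; set u := iter i f b.
  have [y [Ey uy yu]] := cl_lift A0 (cl x) u.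
  rewrite -Ey (_ : y = u + (absz (y - u)%R)%:Z); last lia.
  rewrite abeg_in_arc //; last lia.
  have bu : b <= u := iter_cm_ge fg i b.
  have fuz : f u <= iter j f x.
    by rewrite -E /u -iterS; apply: (iter_cm_le fg).
  rewrite -/f => /andP[y0 yf]; have yx : y = x by apply: (cl_inj Ey); lia.
  lia.
have [i ix imin] : exists2 i, x <= iter i f b & forall i', x <= iter i' f b -> (i <= i')%N.
  have ex : exists i, x <= iter i f b by exists j; rewrite E.
  by case: (ex_minnP ex) => i; exists i.
case: i ix imin => [|i] /= ix imin; first by rewrite leNgt bx in ix.
have ij : (i < j)%N by apply: imin; rewrite E.
have ib : iter i f b < x by rewrite ltNge; apply/negP => /imin; rewrite ltnn.
exists (Ordinal ij); rewrite /= iter_Fr_cl.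
have -> : x = iter i f b + (absz (x - iter i f b)%R)%:Z by lia.
have flt := fwd_lt A0 hM (iter i f b).
rewrite abeg_in_arc //; first by rewrite -/f; lia.
by rewrite -/f in flt; lia.
Qed.

Lemma pow_rank_lt x y : iter j f x = iter j f y -> x < y ->
  (pow_rank M j (cl x) < pow_rank M j (cl y))%N.
Proof.
move=> E xy; apply: proper_card; apply/properP; split.
  apply/fintype.subsetP => B; rewrite !inE => /andP[/eqP EB].
  rewrite iter_Fr_cl in EB; have [b Eb fb] := lift_iter EB.
  rewrite -Eb rank_mem // => bx; rewrite rank_mem ?fb // (lt_trans bx) // andbT.
  by rewrite !iter_Fr_cl fb E.
exists (cl x); rewrite !inE.
  by rewrite rank_mem // xy andbT !iter_Fr_cl E.
by rewrite rank_mem // ltxx andbF.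
Qed.

End Rank.

(** The power ends just after the beginning point of u = f^i(x) - n, where x <= u <= f(x). No
    extreme lies between these two points, so the power ends inside the arc x. *)
Lemma power_wraps i x : x + n%:Z <= iter i f x -> iter i f x <= f x + n%:Z ->
  arc_points (power M i) (cl x) `<=` arc_points M (cl x).
Proof.
move=> xi ix q [hq]; have [C0 bnd _ _ _] := hM.
have := power_end i (cl x); rewrite iter_Fr_cl /=.
set t' := pow_end M i _ _ => -[lt t'C spec _].
set u := iter i f x - n%:Z; have clu : cl (iter i f x) = cl u.
  by rewrite -(subrK n%:Z (iter i f x)) /cl cl_per1.
rewrite clu in lt spec.
have [xu uf] : x <= u /\ u <= f x by rewrite /u; lia.
rewrite fwdE // in uf; set uq := (u %/ n%:Z)%Z.
have uS : lift_beg M A0 u = abeg M (cl u) + clen M * uq%:~R by [].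
have ht' : 0 <= t' < clen M.
  by rewrite t'C andbT ltW // (le_lt_trans _ lt) //; case/andP: (bnd false (cl u)).
have T'T : t' + clen M * uq%:~R < lift_end M A0 x.
  have := lift_end_lt_beg A0 hM x => TS.
  have SS : lift_beg M A0 x <= lift_beg M A0 u by rewrite lift_beg_le.
  have [E|E] := @circle_quo01 _ _ C0 _ (aend M (cl x)) uq
    ((x %/ n%:Z)%Z + external M (cl x)) (bnd false (cl u)) (bnd true (cl x))
    (ltW uf) (lt_le_trans TS (lerD SS (lexx _))).
  - rewrite /lift_end E ltrD2r ltNge; have := spec true (cl x); rewrite /= => ->.
    by rewrite -ltNge; move: uf; rewrite uS /lift_end E ltrD2r.
  - rewrite /lift_end E mulrzDr mulrDr mulr1.
    by have := bnd true (cl x); move: ht' => /= /andP[? ?] /andP[? ?]; lra.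
have Sx : lift_beg M A0 x = abeg M (cl x) + clen M * (x %/ n%:Z)%Z%:~R by [].
have [P [m [P1 P2 E]]] := lift_point A0 hM x hq.
have Sut : lift_beg M A0 x < t' + clen M * uq%:~R.
  by apply: le_lt_trans (_ : lift_beg M A0 u < _); rewrite ?lift_beg_le // uS ltrD2r.
have TS := lift_end_lt_beg A0 hM x.
rewrite (in_arc_lift C0 (bnd false (cl x)) ht' hq Sx erefl _ Sut _ P1 P2 (m := m)).
- move=> /andP[PT SP]; split=> //; rewrite (in_arcE hM P1 P2 hq E) SP andbT.
  exact: lt_trans PT T'T.
- by rewrite E subrK.
- exact: lt_trans T'T TS.
Qed.

(** Without external arcs [f] never leaves a block of n indices. Otherwise, if f^(i-1)(x) < x + n <=
    f^i(x) with i > 1, then f^i(x) <= f(x) + n, and [power_wraps] contradicts the minimality of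
    [omega]. *)
Lemma omega_short k : (0 < k)%N -> (k < omega M)%N ->
  forall i, (i <= k)%N -> forall x, iter i f x < x + n%:Z.
Proof.
move=> k0; rewrite /omega; have n0 := ord_gt0 A0; case: ifP => [/forallP pig _ i _ x|_].
  set b := n%:Z * ((x %/ n%:Z)%Z + 1).
  have [xb bx] : x < b /\ b <= x + n%:Z.
    have := cl_decomp A0 x; have := ltn_ord (cl x); rewrite /cl /b mulrDr mulr1.
    by move: (n%:Z * _) => a; lia.
  suff : iter i f x < b by lia.
  have fb y : y < b -> f y < b.
    move=> yb; rewrite ltNge fwdE //; rewrite -leNgt ltW //.
    have yq : (y %/ n%:Z)%Z <= (x %/ n%:Z)%Z.
      by rewrite -ltzD1 ltz_divLR ?(mulrC _ n%:Z) //; lia.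
    have [C0 bnd _ _ _] := hM.
    rewrite /lift_end (negPf (pig _)) addr0.
    have hC : clen M * (y %/ n%:Z)%Z%:~R <= clen M * (x %/ n%:Z)%Z%:~R.
      by rewrite ler_wpM2l ?(ltW C0) // ler_int.
    have -> : b = 0 + n%:Z * ((x %/ n%:Z)%Z + 1) by rewrite add0r.
    rewrite lift_beg_perz // mulrzDr mulr1z -mulrzr.
    have : 0 <= lift_beg M A0 0.
      by rewrite /lift_beg div0z mulr0 addr0; case/andP: (bnd false (cl 0)).
    by have := bnd true (cl y); move=> /= /andP[? ?] ?; lra.
  by elim: i => //= i; apply: fb.
set P := [set w | _]; move=> kw.
(* The default value 0 of [xget] does not exceed k, so the minimum exists. *)
have Pw : P (xget 0%N P).
  have [ex|no] := pselect (exists w, P w); first exact: xgetPex.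
  by move: kw; rewrite xgetPN // => w Pw; apply: no; exists w.
have nw i : (i <= k)%N -> ~ wraps M i.
  by move=> ik wi; have [_ /(_ _ wi)] := Pw; lia.
elim=> [_ x|i IH ik x]; first by rewrite /=; lia.
case: i IH ik => [|i] IH ik; first exact: fwd_lt.
rewrite ltNge; apply/negP => xi; apply: (nw _ ik); split=> //; exists (cl x).
apply: power_wraps => //=.
have := IH ltac:(lia) x; rewrite /= => lt; rewrite -(cm_per fg).
by apply: (cm_mono fg); apply: ltW.
Qed.

End Power.

(** * Noses and hollows *)

Section Edges.
Variables (R : realType) (n : nat) (M : arc_family R n) (A0 : 'I_n).
Hypothesis hM : is_pca M.
Let cl := cl A0.
Let f := fwd M A0.
Let g := bwd M A0.
Let fg : circle_map n f g := fwd_bwd A0 hM.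

(* Otherwise f is constant modulo n, and the cyclic search for H_l and H_r fails
   on all the arcs. *)
Definition fwd_varies : Prop := forall x, g (x + 1) < g x + n%:Z.

Lemma lift_Fl A z : Fl M A = cl z -> exists2 x, cl x = A & g x = z.
Proof.
rewrite -{1}(cl_idx A0 A) Fl_cl // => /cl_eq[q E].
exists ((A : nat)%:Z + n%:Z * - q); first by rewrite /cl cl_per cl_idx.
by rewrite (per_mulz (cm_adj_per fg)) [g _]E mulrzz mulrN addrK.
Qed.

Lemma lift_Fr A z : Fr M A = cl z -> exists2 x, cl x = A & f x = z.
Proof. exact: (@lift_iter _ _ _ A0 hM 1%N). Qed.

Lemma Hl_some v A : Hl M (cl v) = Some A -> exists2 u, cl u = A & f u = v.
Proof.
by rewrite /Hl; case: pickP => // B /andP[/eqP FB _] [<-]; apply: lift_Fr.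
Qed.

Lemma Hl_none v : g v = g (v + 1) -> Hl M (cl v) = None.
Proof.
move=> E; case H: (Hl M (cl v)) => [A|] //; have [u _ fu] := Hl_some H.
by have := cm_gal fg v u; have := cm_gal fg (v + 1) u; lia.
Qed.

Lemma Hr_none v : f (v - 1) = f v -> Hr M (cl v) = None.
Proof.
move=> E; rewrite /Hr; case: pickP => // B /andP[/eqP FB _].
have [w _ gw] := lift_Fl FB.
by have := cm_gal fg w v; have := cm_gal fg w (v - 1); lia.
Qed.

(** The arc picked is the last point u of the fibre over v. By [fwd_varies], f(u + 1) is strictly
    between v and v + n, so it differs from v on the circle and not only on the line. *)
Lemma Hl_nondeg v : fwd_varies -> g v < g (v + 1) ->
  Hl M (cl v) = Some (cl (g (v + 1) - 1)).
Proof.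
move=> nd lt; rewrite /Hl; have gal := cm_gal fg.
have sub u : f u = v -> Fr M (Ra (cl u)) != cl v -> u = g (v + 1) - 1.
  move=> fu; rewrite Ra_cl Fr_cl // -/f => ne.
  have : f (u + 1) != v by apply: contraNneq ne => ->.
  by have := gal (v + 1) u; have := gal (v + 1) (u + 1);
     have := cm_mono fg (_ : u <= u + 1); lia.
case: pickP => [B /andP[/eqP FB neB]|no].
  by have [u Eu fu] := lift_Fr FB; rewrite -Eu in neB *; rewrite (sub u fu neB).
set u := g (v + 1) - 1; have := no (cl u).
rewrite Ra_cl !Fr_cl // -/f; have -> : f u = v.
  by have := gal (v + 1) u; have := gal v u; rewrite /u; lia.
rewrite eqxx /= => /negbFE/eqP/cl_eq[q].
have fu1 : v + 1 <= f (u + 1) by rewrite gal /u subrK.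
have fun1 : f (u + 1) < v + n%:Z.
  by rewrite (cm_gt fg) (cm_adj_per fg) /u subrK.
move=> Eq; have n0 := ord_gt0 A0; exfalso.
have [q0|q0] := lerP q 0.
  have : n%:Z * q <= n%:Z * 0 by rewrite ler_wpM2l //; lia.
  lia.
have : n%:Z * 1 <= n%:Z * q by rewrite ler_wpM2l //; lia.
lia.
Qed.

(** Some fibre of [f] contains a whole period, and x <= f(x) < x + n forces the common value to be
    the last point of that period. *)
Lemma fwd_constant : ~ fwd_varies -> exists a, forall x,
  a <= x -> x < a + n%:Z -> f x = a + n%:Z - 1 /\ g x = a.
Proof.
move=> nd; have [v lt] : exists v, g v + n%:Z <= g (v + 1).
  apply: contrapT => no; apply: nd => v; rewrite ltNge; apply/negP => le.
  by apply: no; exists v.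
have gal := cm_gal fg; have n0 := ord_gt0 A0.
have fv x : g v <= x -> x < g v + n%:Z -> f x = v.
  by have := gal v x; have := gal (v + 1) x; lia.
have vE : v = g v + n%:Z - 1.
  have := cm_ge fg (g v + n%:Z - 1); have := fwd_lt A0 hM (g v); rewrite -/f.
  by rewrite !fv; lia.
exists (g v) => x x1 x2; split; first by rewrite fv.
have := gal x (g v); have := gal x (g v - 1); have := gal v (g v - 1).
have := cm_per fg (g v - 1); rewrite (fv (g v)) //; last lia.
rewrite (_ : g v - 1 + n%:Z = g v + n%:Z - 1); last lia.
by rewrite fv; lia.
Qed.

Section Constant.
Variable a : int.
Hypothesis deg : forall x, a <= x -> x < a + n%:Z -> f x = a + n%:Z - 1 /\ g x = a.

Lemma constant_Hl A : Hl M A = None.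
Proof.
have F B : Fr M B = cl (a + n%:Z - 1).
  by have [x [<- x1 x2]] := cl_lift A0 B a; rewrite Fr_cl // -/f (proj1 (deg _ _)).
by rewrite /Hl; case: pickP => // B /andP[/eqP <-]; rewrite !F eqxx.
Qed.

Lemma constant_Hr A : Hr M A = None.
Proof.
have F B : Fl M B = cl a.
  by have [x [<- x1 x2]] := cl_lift A0 B a; rewrite Fl_cl // -/g (proj2 (deg _ _)).
by rewrite /Hr; case: pickP => // B /andP[/eqP <-]; rewrite !F eqxx.
Qed.

End Constant.

Lemma Hl_iter_some i v A : Hl_iter M i (cl v) = Some A ->
  exists2 u, cl u = A & iter i f u = v.
Proof.
elim: i A => [|i IH] A; first by case=> <-; exists v.
rewrite /Hl_iter iterS -/(Hl_iter M i (cl v)).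
case E: (Hl_iter _ _ _) => [B|] //=; have [w <- fw] := IH _ E.
by move=> /Hl_some[u Eu fu]; exists u; rewrite // -iterS iterSr fu.
Qed.

Lemma Hl_iter_chain i u : fwd_varies -> chain f g i u ->
  Hl_iter M i (cl (iter i f u)) = Some (cl u).
Proof.
move=> nd; elim: i u => [|i IH] u ch //.
rewrite iterSr /Hl_iter iterS -/(Hl_iter M i _) IH /=; last first.
  by move=> j ji; have := ch j.+1 ji; rewrite [iter j.+2 _ _]iterSr [iter j.+1 f u]iterSr.
have g1 : g (f u + 1) = u + 1 := ch 0%N isT.
have g0 : g (f u) <= u by rewrite -(cm_gal fg).
by rewrite Hl_nondeg ?g1 ?addrK //; lia.
Qed.

(** The power A^i stops right after s(L(B)), so it does not extend to the next beginning point
    s(B). *)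
Lemma is_noseP i A B : Hl_iter M i (La B) = Some A -> is_nose M i A B.
Proof.
move=> H; rewrite /is_nose H eqxx andbT.
have [_ bnd inj mono _] := hM.
have Z : iter i (Fr M) A = La B.
  move: H; rewrite -(cl_idx A0 (La B)) => /Hl_iter_some[u <- <-].
  by rewrite iter_Fr_cl.
have lt1 := power_beg_lt A0 hM i A.
rewrite /in_arc [abeg (power M i) A]/(abeg M A) Z in lt1 *.
have LB : (La B : nat) = if (B : nat) == 0%N then n.-1 else (B : nat).-1.
  rewrite /La /=; have := ltn_ord B; case: (B : nat) => [|b] bn /=.
    by rewrite add0n modn_small // ltn_predL (leq_trans _ bn).
  by rewrite modnDr modn_small //; lia.
rewrite !lt1 LB; have bn := ltn_ord B; have an := ltn_ord A.
have lem (X Y : 'I_n) : (abeg M X < abeg M Y) = (X < Y)%N.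
  by apply: (leW_mono (le_mono _)) => // x y; apply: mono.
by rewrite lem; case: ifP; case: ifP; lia.
Qed.

Lemma is_hollowP a b : f a = b -> g b = a -> a != b -> is_hollow M (cl b) (cl a).
Proof.
move=> fa gb ab; rewrite /is_hollow Fr_cl // Fl_cl // -/f -/g fa gb !eqxx !andbT.
have [_ bnd inj mono _] := hM.
have Z : iter 1 (Fr M) (cl a) = cl b by rewrite iter_Fr_cl //= -/f fa.
have lt1 := power_beg_lt A0 hM 1 (cl a).
rewrite /in_arc [abeg (power M 1) _]/(abeg M _) Z in lt1 *.
have lem (X Y : 'I_n) : (abeg M X < abeg M Y) = (X < Y)%N.
  by apply: (leW_mono (le_mono _)) => // x y; apply: mono.
have ne : cl a != cl b.
  apply: contra_neq ab => /cl_inj; apply; rewrite -fa.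
    by have := cm_ge fg a; have := ord_gt0 A0; lia.
  exact: fwd_lt.
rewrite !lt1 lem leqnn; case: ifP; rewrite -?val_eqE /= in ne *; lia.
Qed.

End Edges.

(** * The lift of the synthetic graph *)

Section Synthetic.
Variables (R : realType) (n k : nat) (M : arc_family R n) (A0 : 'I_n).
Hypothesis hM : is_pca M.
Let cl := cl A0.
Let f := fwd M A0.
Let g := bwd M A0.
Let fg : circle_map n f g := fwd_bwd A0 hM.
Hypothesis short : forall i, (i <= k)%N -> forall x, iter i f x < x + n%:Z.

Definition idx (A : 'I_n) : int := (A : nat)%:Z.

Lemma idx_ge0 A : 0 <= idx A. Proof. by []. Qed.

Lemma idx_lt A : idx A < n%:Z. Proof. by rewrite /idx; have := ltn_ord A; lia. Qed.

(* The lift of the target of an edge whose source is lifted to its index. *)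
Definition head_lift (x : edge n k) : int := idx (tgt x) - n%:Z * ext x.

Lemma window_uniq (x y b : int) q : y = x + n%:Z * q ->
  b <= x -> x < b + n%:Z -> b <= y -> y < b + n%:Z -> q = 0.
Proof.
move=> -> h1 h2 h3 h4; have n0 := ord_gt0 A0; apply/eqP; case: ltgtP => // q0.
  have : n%:Z * q <= n%:Z * -1 by rewrite ler_wpM2l //; lia.
  lia.
have : n%:Z * 1 <= n%:Z * q by rewrite ler_wpM2l //; lia.
lia.
Qed.

(** By [short] the lifted head lies after the index of A, by at most n. The only lift of B there is
    its index, or its index plus n when B <= A, as [ext] records. *)
Lemma nose_lift (i : 'I_k.+1) A B : (Some i, A, B) \in Sgraph M k ->
  iter i f (idx A) + 1 = head_lift (Some i, A, B).
Proof.
rewrite !inE /= => /andP[/andP[_ /eqP H] _].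
rewrite -(cl_idx A0 B) La_cl in H.
have [u clu fu] := Hl_iter_some hM H.
have [q Eq] := cl_eq (etrans clu (esym (cl_idx A0 A))).
have E : iter i f (idx A) + 1 = idx B - n%:Z * q.
  move: fu; rewrite Eq (per_mulz (iter_cm_per fg i)) mulrzz -/(idx A) -/(idx B).
  by rewrite -/f; lia.
have lo := iter_cm_ge fg i (idx A); have hi := short (ltn_ord i) (idx A).
rewrite E /head_lift /ext /tgt /src /=; have n0 := ord_gt0 A0.
have [a0 an b0 bn] := And4 (idx_ge0 A) (idx_lt A) (idx_ge0 B) (idx_lt B).
case: ifP => le.
  have {}le : idx B <= idx A by rewrite /idx; lia.
  suff qE : - (q + 1) = 0 by rewrite (_ : q = -1) //; lia.
  have En : n%:Z * - (q + 1) = - (n%:Z * q) - n%:Z by ring.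
  by apply: (@window_uniq (idx B + n%:Z) (iter i f (idx A) + 1) (idx A + 1)); lia.
have {}le : idx A < idx B by rewrite /idx; lia.
suff qE : - q = 0 by rewrite (_ : q = 0) //; lia.
have En : n%:Z * - q = - (n%:Z * q) by ring.
by apply: (@window_uniq (idx B) (iter i f (idx A) + 1) (idx A + 1)); lia.
Qed.

Lemma hollow_lift A B : (None, A, B) \in Sgraph M k ->
  f (head_lift (None, A, B)) = idx A /\ g (idx A) = head_lift (None, A, B).
Proof.
rewrite !inE /= andbT => /and3P[ne /eqP EA /eqP EB].
have EA' : Fr M B = cl (idx A) by rewrite /cl cl_idx.
rewrite -(cl_idx A0 A) Fl_cl // -/(idx A) -/g in EB.
set a := g (idx A) in EB *; have n0 := ord_gt0 A0.
have faA : f a = idx A.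
  move: EA'; rewrite EB Fr_cl // => /cl_inj; apply; rewrite -/f.
    by rewrite (cm_gt fg) (cm_adj_per fg) -/a; lia.
  have : idx A <= f a by rewrite (cm_gal fg).
  by lia.
suff -> : head_lift (None, A, B) = a by [].
have [q Eq] := cl_eq (etrans (esym EB) (esym (cl_idx A0 B))).
rewrite -/(idx B) in Eq; have lo := bwd_gt A0 hM (idx A); have hi := cm_adj_le fg (idx A).
rewrite -/g -/a in lo hi.
have [a0 an b0 bn] := And4 (idx_ge0 A) (idx_lt A) (idx_ge0 B) (idx_lt B).
(* An arc does not contain its own beginning point, so a hollow is not a loop; for a loop [ext]
   would be 1 although the lift does not move. *)
have nAB : idx A != idx B.
  apply: contraTneq ne => /eqP; rewrite /idx eqz_nat => /eqP/val_inj ->.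
  by rewrite /in_arc ltxx /=; case: ifP => // ->.
rewrite /head_lift /ext /tgt /src /=; case: ifP => le.
  have {}le : idx A <= idx B by rewrite /idx; lia.
  suff qE : q + 1 = 0 by rewrite Eq mulr1 (_ : q = -1) ?mulrN1 //; lia.
  have En : n%:Z * (q + 1) = n%:Z * q + n%:Z by ring.
  by apply: (@window_uniq (idx B - n%:Z) a (idx A - n%:Z + 1)); lia.
have {}le : idx B < idx A by rewrite /idx; lia.
suff q0 : q = 0 by move: Eq; rewrite q0; lia.
by apply: (@window_uniq (idx B) a (idx A - n%:Z + 1)); lia.
Qed.

Lemma edge_step x q : x \in Sgraph M k ->
  let y := idx (src x) + n%:Z * q in let y' := head_lift x + n%:Z * q in
  if kind x is Some i then iter i f y + 1 = y' /\ bal x = (i : nat)%:Z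
  else [/\ f y' = y, g y = y' & bal x = -1].
Proof.
case: x => [[[i|] A] B] xS y y'; rewrite /= /y' -?(nose_lift xS).
  by rewrite /y (per_mulz (iter_cm_per fg i)) mulrzz addrAC.
have [fh gA] := hollow_lift xS.
by rewrite /y (per_mulz (cm_per fg)) (per_mulz (cm_adj_per fg)) !mulrzz fh gA.
Qed.

(** For b < 0 the iterates of [g] take the place of f^b, and g^|b|(x0) <= y is written with [f] by
    adjunction. The relation persists along every edge when the balance is added to b. *)
Let ahead x0 (b y : int) : Prop :=
  if b is Posz m then iter m f x0 < y else x0 <= iter (absz b) f y.

Let ahead_nose x0 b y (i : nat) : ahead x0 b y -> ahead x0 (b + i%:Z) (iter i f y + 1).
Proof.
case: b => [m|m].
  rewrite -PoszD addnC /ahead iterD => lt; have := iter_cm_mono fg i (ltW lt); lia.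
rewrite {1}/ahead => le; have [im|mi] := ltnP i m.+1.
  have -> : Negz m + i%:Z = Negz (m - i) by rewrite !NegzE; lia.
  apply: (le_trans le); have -> : absz (Negz m) = ((m - i).+1 + i)%N by rewrite /=; lia.
  by rewrite iterD; apply: (iter_cm_mono fg); lia.
have -> : Negz m + i%:Z = (i - m.+1)%N by rewrite !NegzE; lia.
rewrite /=; have -> : iter i f y = iter (i - m.+1) f (iter m.+1 f y).
  by rewrite -iterD subnK.
have := iter_cm_mono fg (i - m.+1) le; rewrite /=; lia.
Qed.

Let ahead_hollow x0 b y : ahead x0 b (f y) -> ahead x0 (b - 1) y.
Proof.
case: b => [[|m]|m].
- by move/ltW.
- have -> : m.+1%:Z - 1 = m by lia.
  by rewrite /ahead /= !ltNge; apply: contra; apply: (cm_mono fg).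
- have -> : Negz m - 1 = Negz m.+1 by rewrite !NegzE; lia.
  by rewrite /ahead /= -!iterSr.
Qed.

Lemma ahead_edge x0 b x q : x \in Sgraph M k ->
  ahead x0 b (idx (src x) + n%:Z * q) -> ahead x0 (b + bal x) (head_lift x + n%:Z * q).
Proof.
move=> /(edge_step q) /=; case: (kind x) => [i [<- ->]|[<- _ ->]].
  exact: ahead_nose.
exact: ahead_hollow.
Qed.

Lemma ahead_walk x0 W u v b q : walk (Sgraph M k) u W v ->
  ahead x0 b (idx u + n%:Z * q) ->
  ahead x0 (b + weight (@bal n k) W) (idx v + n%:Z * (q - weight (@ext n k) W)).
Proof.
elim: W u b q => [|x W IH] u b q /=.
  by move=> /eqP ->; rewrite !weight_nil addr0 subr0.
move=> /and3P[xS /eqP <- wW] /(ahead_edge xS) H.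
rewrite !weight_cons addrA opprD addrA; apply: IH wW _.
by rewrite mulrBr addrA addrAC.
Qed.

Lemma ext0_bal W : is_cycle (Sgraph M k) W -> weight (@ext n k) W = 0 ->
  weight (@bal n k) W < 0.
Proof.
case=> W_ne [u /andP[wW _]] e0; case: W W_ne wW e0 => // x W _.
move=> /= /and3P[xS /eqP su wW]; set x0 := idx u.
(* The relation fails at x0 with balance 0, so it is started after the first edge. *)
have : ahead x0 (bal x) (idx (tgt x) + n%:Z * - ext x).
  have := edge_step 0 xS; rewrite su mulr0 !addr0 -/x0 mulrN -/(head_lift x).
  case: (kind x) => [i [<- ->]|[fh _ ->]] /=; first by lia.
  by rewrite fh.
move=> /(ahead_walk wW); rewrite !weight_cons => + e0.
have -> : idx u + n%:Z * (- ext x - weight (@ext n k) W) = x0.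
  by rewrite -opprD e0 oppr0 mulr0 addr0.
case: (bal x + _) => [m|m] /=; last by [].
by rewrite ltNge (iter_cm_ge fg).
Qed.

(** If [ext] < 0, the maximality of [ratiok] makes the first coordinate at most 0 and [ext] breaks
    the tie. If [ext] > 0, the gap to [RATIOk] makes it negative. If [ext] = 0, it is the
    balance. *)
Lemma ratio_lex : ((ratiok M k)%:E < RATIOk M k)%E ->
  forall W, is_cycle (Sgraph M k) W -> (lexW M W < ((0, 0) : lexT))%O.
Proof.
move=> rR W cW; rewrite lexWE ltxi_pair.
set b := weight (@bal n k) W; set e := weight (@ext n k) W.
case: (ltrgtP e 0) => [e0|e0|e0].
- have /(proj2 (ratiokP _)) := ex_intro _ W (And3 cW e0 erefl) : neg_ratios M k (Defs.ratio W).
  move=> /(_ (ex_intro _ _ (ex_intro _ W (And3 cW e0 erefl)))).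
  rewrite /Defs.ratio -/b -/e ler_ndivrMr ?ltrz0 // => le.
  by rewrite implybT andbT; lra.
- have ex : pos_ratios M k (Defs.ratio W) by exists W.
  have [r [[W' [_ _ _]] rmin] Er] := RATIOkP (ex_intro _ _ ex).
  have := rmin _ ex; move: rR; rewrite Er lte_fin /Defs.ratio -/b -/e.
  rewrite ler_pdivlMr ?ltr0z // => rr le.
  have lt : b%:~R + ratiok M k * e%:~R < 0 :> rat.
    have : ratiok M k * e%:~R < r * e%:~R by rewrite ltr_pM2r ?ltr0z.
    by lra.
  by rewrite (ltW lt) leNgt lt.
- have := ext0_bal cW e0; rewrite -/b e0 mulr0 addr0 implybF.
  by rewrite ler0z lerz0 -ltNge => b0; rewrite (ltW b0).
Qed.

Lemma noses0_ext W : noses W = 0%N -> 0 <= weight (@ext n k) W.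
Proof.
elim: W => [|x W IH]; first by rewrite weight_nil.
rewrite weight_cons /noses /= => /eqP; rewrite addn_eq0 => /andP[kx /eqP/IH].
by apply: addr_ge0; rewrite /ext; move: kx; case: (kind x) => // _; case: ifP.
Qed.

Lemma potential_walk (V : realFieldType) (P : 'I_n -> V) (w : edge n k -> V)
    (D : {set edge n k}) u W v :
  (forall x, x \in D -> P (src x) + w x <= P (tgt x)) ->
  walk D u W v -> P u + weight w W <= P v.
Proof.
move=> PD; elim: W u => [|x W IH] u /=; first by move/eqP ->; rewrite weight_nil addr0.
move=> /and3P[xD /eqP <- /IH]; rewrite weight_cons; have := PD x xD; lra.
Qed.

(** Around a cycle, l bal + c ext + (number of noses) <= 0. If some cycle has [ext] > 0 then l > 0,
    the ratios of such cycles are at least c/l, and those of the cycles with [ext] < 0 are below c/l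
    because these cycles contain a nose. *)
Lemma potential_ratio (V : realFieldType) (P : 'I_n -> V) (c l : V) :
  0 < c -> 0 <= l ->
  (forall x, x \in Sgraph M k ->
    P (src x) + (l * (bal x)%:~R + c * (ext x)%:~R + (kind x != None)%:R) <= P (tgt x)) ->
  ((ratiok M k)%:E < RATIOk M k)%E.
Proof.
move=> c0 l0 PS.
have cyc W : is_cycle (Sgraph M k) W ->
    l * (weight (@bal n k) W)%:~R + c * (weight (@ext n k) W)%:~R + (noses W)%:R <= 0.
  case=> _ [u /andP[wW _]]; have := potential_walk PS wW.
  rewrite gerDl; congr (_ <= 0).
  elim: (W) => [|x W' IH]; first by rewrite !weight_nil /noses /= !mulr0 !addr0.
  by rewrite !weight_cons IH !mulrzDr /noses /= natrD; ring.
have [pex|no] := pselect (exists r, pos_ratios M k r); last first.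
  rewrite /RATIOk; case: asboolP => [[r Pr]|_]; last exact: ltry.
  by case: (no (ex_intro _ r Pr)).
have [r [[W [cW e0 ->]] _] ->] := RATIOkP pex; rewrite lte_fin /Defs.ratio.
have := cyc W cW; set b := weight _ W; set e := weight (@ext n k) W in e0 *.
have e0' : 0 < e%:~R :> V by rewrite ltr0z.
have N0 : 0 <= (noses W)%:R :> V by [].
move=> bnd; have lb : l * b%:~R <= - (c * e%:~R) by lra.
have ce : 0 < c * e%:~R by rewrite mulr_gt0.
have {}l0 : 0 < l.
  by rewrite lt_neqAle l0 andbT; apply/eqP => E; move: lb; rewrite -E mul0r; lra.
have b0 : b < 0.
  rewrite -(ltrz0 V) ltNge; apply/negP => b0.
  by have := mulr_ge0 (ltW l0) b0; lra.
rewrite ltr_pdivlMr ?ltr0z //.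
(* Without cycles of negative [ext] the value of [ratiok] is the default 0, and the ratio of W is
   positive as its balance is negative. *)
have [nex|no] := pselect (exists r, neg_ratios M k r); last first.
  by rewrite ratiok0 // mul0r oppr_gt0 ltrz0.
have [[W' [cW' e0'' ->]] _] := ratiokP nex; rewrite /Defs.ratio.
have := cyc W' cW'; set b' := weight _ W'; set e' := weight (@ext n k) W' in e0'' *.
have N1 : 1 <= (noses W')%:R :> V.
  by rewrite ler1n lt0n; apply/eqP => /noses0_ext; rewrite leNgt e0''.
move=> bnd'; rewrite mulrAC ltr_ndivrMr ?ltrz0 // !mulNr ltrN2.
rewrite -!rmorphM /= ltr_int -(ltr_int V) !rmorphM /=.
rewrite -(ltr_pM2l l0) !mulrA.
have e1 : e'%:~R < 0 :> V by rewrite ltrz0.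
have : l * b'%:~R * e%:~R < - (c * e'%:~R) * e%:~R by rewrite ltr_pM2r //; lra.
have : l * b%:~R * - e'%:~R <= - (c * e%:~R) * - e'%:~R by rewrite ler_pM2r ?oppr_gt0.
lra.
Qed.

End Synthetic.

(** * Potentials *)

Section Potential.
Variables (R : realType) (n k : nat) (M : arc_family R n) (A0 : 'I_n).
Hypothesis hM : is_pca M.
Hypothesis k_gt0 : (0 < k)%N.
Let cl := cl A0.
Let f := fwd M A0.
Let g := bwd M A0.
Let fg : circle_map n f g := fwd_bwd A0 hM.
Hypothesis short : forall i, (i <= k)%N -> forall x, iter i f x < x + n%:Z.

Definition lift_pot (P : 'I_n -> rat) (c : rat) (x : int) : rat :=
  P (cl x) + c * (x %/ n%:Z)%Z%:~R.

Lemma lift_potE P c A q : lift_pot P c (idx A + n%:Z * q) = P A + c * q%:~R.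
Proof.
rewrite /lift_pot /cl (cl_per A0) cl_idx [idx A + _]addrC [n%:Z * q]mulrC divzMDl; last first.
  by have := ord_gt0 A0; lia.
by rewrite divz_small ?addr0 // /idx; have := ltn_ord A; lia.
Qed.

Lemma lift_edge x q : x \in Sgraph M k ->
  forall P c l, P (src x) + sep c l x <= P (tgt x) ->
  lift_pot P c (idx (src x) + n%:Z * q) +
    (l * (bal x)%:~R + (if kind x is Some _ then 2 else 0)) <=
  lift_pot P c (head_lift x + n%:Z * q).
Proof.
move=> xS P c l.
have -> : head_lift x + n%:Z * q = idx (tgt x) + n%:Z * (q - ext x).
  by rewrite /head_lift; ring.
by rewrite !lift_potE /sep mulrzDr mulrNz; lra.
Qed.

Lemma seps_of_pot (P : 'I_n -> rat) (c l : rat) : fwd_varies M A0 -> 0 <= l ->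
  (forall x, x \in Sgraph M k -> P (src x) + sep c l x <= P (tgt x)) ->
  seps n f g k (lift_pot P c) c l.
Proof.
move=> nd l0 PS; have pos x : exists q, x = idx (cl x) + n%:Z * q.
  by exists (x %/ n%:Z)%Z; apply: cl_decomp.
split=> [x|a b fa gb|i x ik ch flat].
- rewrite /lift_pot /cl cl_per1 (quo_per A0) mulrzDr; ring.
- have [->|ab] := eqVneq a b; first by rewrite lerDl.
  pose e : edge n k := (None, cl b, cl a).
  have eS : e \in Sgraph M k.
    by rewrite !inE /= is_hollowP //.
  have [q Eb] := pos b.
  have := edge_step hM short q eS; have := lift_edge q eS (PS _ eS).
  rewrite /= -Eb -/g gb => le [_ Ea _]; move: le.
  by rewrite -Ea /bal /=; lra.
- have ik1 : (i < k.+1)%N by [].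
  set y := iter i f x + 1.
  have Ly : La (cl y) = cl (iter i f x) by rewrite La_cl addrK.
  pose e : edge n k := (Some (Ordinal ik1), cl x, cl y).
  have eS : e \in Sgraph M k.
    rewrite !inE /= is_noseP //; last by rewrite Ly Hl_iter_chain.
    case: flat => [E|[gx fx]]; first by rewrite /is_short /= E ltnn.
    rewrite /is_short /= /src /tgt /= Hl_none // Hr_none // /y ?addrK //=.
    by rewrite andbF.
  have [q Ex] := pos x.
  have := edge_step hM short q eS; have := lift_edge q eS (PS _ eS).
  rewrite /= /src /tgt /= -Ex -/f -/y => le [Ey _]; move: le.
  by rewrite -Ey /bal /= -pmulrn; lra.
Qed.

(** * Potentials from longest walks, and reachability from [A0] *)

Section Reachable.
Hypothesis lex_neg : forall W, is_cycle (Sgraph M k) W -> (lexW M W < ((0, 0) : lexT))%O.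
Variables (e l c : rat).
Hypothesis eE : e = (4 * n)%:R.
Hypothesis lE : l = e ^+ 3.
Hypothesis cE : c = l * ratiok M k + e.

(** The walks may start anywhere, so that the maximum also exists at the arcs that are not known to
    be reachable from [A0]. *)
Lemma lex_potential : exists P : 'I_n -> rat,
  forall x, x \in Sgraph M k -> P (src x) + sep c l x <= P (tgt x).
Proof.
have H v : exists u P, [/\ True, is_path (Sgraph M k) u P v &
    forall u' W, True -> walk (Sgraph M k) u' W v -> weight (sep c l) W <= weight (sep c l) P].
  apply: (@max_walk n k _ rat _ (@sep n k c l) id (Sgraph M k) (fun=> True)).
  - by move=> a b d; rewrite lerD2r.
  - by move=> W cW; apply: ltW; apply: (sep_neg A0 lex_neg eE lE cE).
  - by exists v, [::]; split=> //=.
have H' v : exists r : rat, is_max [set r | exists u W, walk (Sgraph M k) u W v /\ r = weight (sep c l) W] r.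
  have [u [P [_ /path_walk wP Pmax]]] := H v; exists (weight (sep c l) P).
  by split; [exists u, P|move=> r [u' [W [wW ->]]]; apply: Pmax wW].
exists (fun v => sval (cid (H' v))) => x xS.
have [[u [W [wW ->]]] _] := svalP (cid (H' (src x))).
have [_] := svalP (cid (H' (tgt x))); apply; exists u, (W ++ [:: x]).
rewrite walk_cat -(walk_endP wW) wW /= xS !eqxx.
by rewrite weight_cat (weight_cons _ x) weight_nil addr0.
Qed.

(** No edge leaves the set of reachable arcs, so lowering a potential by a constant outside it keeps
    the inequalities of the edges. If A is reachable and the next arc B is not, the constant T
    brings B down to the level of A or below, against [seps_step]. *)
Lemma reachable : A0 = 0%N :> nat -> forall v, exists W, walk (Sgraph M k) A0 W v.
Proof.
move=> A00; pose Rch v := exists W, walk (Sgraph M k) A0 W v.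
have step (A B : 'I_n) : (B = A.+1 :> nat) -> Rch A -> Rch B.
  move=> BA RA; have iBA : idx B = idx A + 1 by rewrite /idx BA; lia.
  have clB : cl (idx A + 1) = B by rewrite -iBA /cl cl_idx.
  have LB : La B = A by rewrite -clB La_cl addrK cl_idx.
  have [nd|nnd] := pselect (fwd_varies M A0).
    apply: contrapT => nRB; have [P PS] := lex_potential.
    pose T := `|P A - P B|; have T0 : 0 <= T by rewrite /T.
    pose P' v := P v - (if `[< Rch v >] then 0 else T).
    have P'S x : x \in Sgraph M k -> P' (src x) + sep c l x <= P' (tgt x).
      move=> xS; have := PS x xS; rewrite /P'.
      case: (asboolP (Rch (src x))) => [[W wW]|_].
        case: asboolP => [_|]; first lra.
        case; exists (W ++ [:: x]).
        by rewrite walk_cat -(walk_endP wW) wW /= xS !eqxx.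
      by case: asboolP => _; lra.
    have l0 : 0 <= l by rewrite lE eE exprn_ge0.
    have := seps_step fg (ord_gt0 A0) k_gt0 (seps_of_pot nd l0 P'S) (idx A).
    rewrite -iBA; have EA := lift_potE P' c A 0; have EB := lift_potE P' c B 0.
    rewrite !mulr0 !addr0 in EA EB; rewrite EA EB /P'.
    case: asboolP => // _; case: asboolP => // _.
    by have := ler_norm (P A - P B); have := ler_norm (- (P A - P B)); rewrite normrN -/T; lra.
  (* In this case H_l and H_r are undefined everywhere, so the 0-nose from A to B is not short. *)
  have [a deg] := fwd_constant hM nnd.
  have [W wW] := RA; pose x : edge n k := (Some ord0, A, B).
  exists (W ++ [:: x]); rewrite walk_cat -(walk_endP wW) wW /= !eqxx !andbT.
  rewrite !inE /= is_noseP //; last by rewrite /Hl_iter /= LB.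
  by rewrite /is_short /= (constant_Hl hM deg) (constant_Hr hM deg) andbF.
suff H (m : nat) (v : 'I_n) : (v = m :> nat) -> Rch v by move=> v; exact: (H v v erefl).
elim: m v => [|m IH] v vm.
  by exists [::]; apply/eqP/val_inj; rewrite /= A00 vm.
have mn : (m < n)%N by have := ltn_ord v; lia.
exact: step (IH (Ordinal mn) erefl).
Qed.

End Reachable.

End Potential.

(** * The order of the extremes *)

Section Code.
Variables (R : realType) (n : nat).
Implicit Types (N : arc_family R n) (phi : 'I_n -> int).

(* phi A lifts the last arc that begins before the end of A, with A lifted to its
   index: A is external iff n <= phi A, and then subtracting n moves the end of A
   to the first turn. *)
Definition base phi (A : 'I_n) : int := if n%:Z <= phi A then idx A - n%:Z else idx A.

Definition top phi (A : 'I_n) : int := if n%:Z <= phi A then phi A - n%:Z else phi A.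

Record extreme_code N phi : Prop := Code {
  code_bb : forall A B, (abeg N A < abeg N B) = (idx A < idx B);
  code_be : forall A B, (abeg N B < aend N A) = (idx B <= top phi A);
  code_eb : forall A B, (aend N A < abeg N B) = (top phi A < idx B);
  code_ee : forall A B, (aend N A < aend N B) = (base phi A < base phi B)
}.

Lemma code_equivalent N N' phi : extreme_code N phi -> extreme_code N' phi -> equivalent N N'.
Proof.
case=> bb be eb ee [bb' be' eb' ee']; exists id; split; first by exists id.
by case=> [] [] A B; rewrite /extreme ?bb ?be ?eb ?ee ?bb' ?be' ?eb' ?ee'.
Qed.

Lemma ord_increasing_ge (h : 'I_n -> 'I_n) :
  (forall A B : 'I_n, (A < B)%N -> (h A < h B)%N) -> forall A : 'I_n, (A <= h A)%N.
Proof.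
move=> hh [m mn] /=; elim: m mn => // m IH mn.
have mn' := ltnW mn; apply: leq_ltn_trans (IH mn') _.
exact: (hh (Ordinal mn') (Ordinal mn)).
Qed.

(** An increasing bijection of a finite chain is the identity, so the equivalence does not permute
    the indices. *)
Lemma equivalent_same N N' :
  (forall A B, (abeg N A < abeg N B) = (idx A < idx B)) ->
  (forall A B, (abeg N' A < abeg N' B) = (idx A < idx B)) ->
  equivalent N N' ->
  forall a b A B, (extreme N a A < extreme N b B) = (extreme N' a A < extreme N' b B).
Proof.
move=> bb bb' [h [[h' hK h'K] H]].
have hlt A B : ((h A < h B)%N = (A < B)%N).
  by have := H false false A B; rewrite /= bb bb' /idx !ltz_nat => ->.
suff hid A : h A = A by move=> a b A B; rewrite H !hid.
apply: val_inj; apply/eqP; rewrite eqn_leq; apply/andP; split; last first.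
  by apply: ord_increasing_ge => ? ?; rewrite hlt.
rewrite -{2}(hK A); apply: (@ord_increasing_ge h') => X Y XY.
by rewrite -hlt !h'K.
Qed.

Lemma code_uniq N N' phi phi' : extreme_code N phi -> extreme_code N' phi' ->
  (forall A, idx A <= phi A < idx A + n%:Z) ->
  (forall A, idx A <= phi' A < idx A + n%:Z) ->
  (forall a b A B, (extreme N a A < extreme N b B) = (extreme N' a A < extreme N' b B)) ->
  phi =1 phi'.
Proof.
move=> cN cN' hphi hphi' same A.
have eb (B : 'I_n) : (top phi A < idx B) = (top phi' A < idx B).
  by have := same true false A B; rewrite /= (code_eb cN) (code_eb cN').
have := hphi A; have := hphi' A; have := eb A.
have n0 : (0 < n)%N by have := ltn_ord A; lia.
have t0 : 0 <= top phi A < n%:Z.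
  by rewrite /top; have := hphi A; have := idx_lt A; have := idx_ge0 A; case: ifP; lia.
have t0' : 0 <= top phi' A < n%:Z.
  by rewrite /top; have := hphi' A; have := idx_lt A; have := idx_ge0 A; case: ifP; lia.
have E : top phi A = top phi' A.
  have tn : (absz (top phi A) < n)%N by lia.
  have tn' : (absz (top phi' A) < n)%N by lia.
  have := eb (Ordinal tn); have := eb (Ordinal tn'); rewrite /idx /=; lia.
by move: E; rewrite /top; case: ifP; case: ifP; lia.
Qed.

Variables (A0 : 'I_n) (N : arc_family R n).
Hypothesis pN : is_pca N.

Lemma pca_bb A B : (abeg N A < abeg N B) = (idx A < idx B).
Proof.
have [_ _ _ mono _] := pN; rewrite /idx ltz_nat.
by apply: (leW_mono (le_mono _)) => // x y; apply: mono.
Qed.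

Lemma lift_beg_idx A q : lift_beg N A0 (idx A + n%:Z * q) = abeg N A + clen N * q%:~R.
Proof.
rewrite /lift_beg (cl_per A0) cl_idx [idx A + _]addrC [n%:Z * q]mulrC divzMDl; last first.
  by have := ord_gt0 A0; lia.
by rewrite divz_small ?addr0 // /idx; have := ltn_ord A; lia.
Qed.

Lemma lift_end_idx A q : lift_end N A0 (idx A + n%:Z * q) =
  aend N A + clen N * (q + external N A)%:~R.
Proof.
rewrite /lift_end (cl_per A0) cl_idx [idx A + _]addrC [n%:Z * q]mulrC divzMDl; last first.
  by have := ord_gt0 A0; lia.
by rewrite divz_small ?addr0 // /idx; have := ltn_ord A; lia.
Qed.

Lemma pca_code : A0 = 0%N :> nat -> zero_normalized N A0 ->
  extreme_code N (fun A => fwd N A0 (idx A)).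
Proof.
move=> A00 z0; set phi := fun A => _; have n0 := ord_gt0 A0.
have [C0 _ _ _ _] := pN.
(* By [zero_normalized] no end lies before s(A0), so an arc is external iff its lifted end is beyond
   the next lift of s(A0). *)
have extE A : (n%:Z <= phi A) = external N A.
  rewrite /phi fwdE // (_ : n%:Z = idx A0 + n%:Z * 1); last by rewrite /idx A00; lia.
  rewrite lift_beg_idx -[idx A]addr0 -[0](mulr0 n%:Z) lift_end_idx add0r.
  have ne := abeg_neq_aend pN A0 A; have := z0 true A; rewrite /= le_eqVlt (negPf ne) /=.
  have [C0' bnd _ _ _] := pN; have := bnd true A; have := bnd false A0 => /=.
  move=> /andP[h1 h2] /andP[h3 h4] lt.
  by case: (external N A); rewrite /= ?mulr1z ?mulr0z; lra.
have baseE A : lift_end N A0 (base phi A) = aend N A.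
  rewrite /base extE; case: ifP => ex.
    rewrite (_ : idx A - n%:Z = idx A + n%:Z * -1); last lia.
    by rewrite lift_end_idx ex /= addNr mulr0 addr0.
  by rewrite -[idx A]addr0 -[0](mulr0 n%:Z) lift_end_idx ex /= addr0 mulr0 addr0.
have topE A : fwd N A0 (base phi A) = top phi A.
  rewrite /base /top; case: ifP => // _.
  by have := fwd_per A0 pN (idx A - n%:Z); rewrite subrK /phi => ->; rewrite addrK.
have begE A : lift_beg N A0 (idx A) = abeg N A.
  by rewrite -[idx A]addr0 -[0](mulr0 n%:Z) lift_beg_idx mulr0 addr0.
split=> A B.
- exact: pca_bb.
- by rewrite -topE fwdE // baseE begE.
- rewrite [RHS]ltNge -topE fwdE // baseE begE -leNgt le_eqVlt.
  by rewrite eq_sym (negPf (abeg_neq_aend pN B A)).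
- by rewrite -!baseE lift_end_lt.
Qed.

(** The ends of the power are ordered first by F_r^j and then by rank, and within a fibre of f^j the
    rank increases. *)
Lemma power_code j : (forall x, iter j (fwd N A0) x < x + n%:Z) ->
  extreme_code (power N j) (fun A => iter j (fwd N A0) (idx A)).
Proof.
move=> short; set phi := fun A => _; have n0 := ord_gt0 A0.
have fg := fwd_bwd A0 pN.
have hphi A : idx A <= phi A < idx A + n%:Z by rewrite short (iter_cm_ge fg).
have topE A : idx (iter j (Fr N) A) = top phi A.
  rewrite -{1}(cl_idx A0 A) (iter_Fr_cl A0 pN) -/(idx A).
  rewrite (_ : cl A0 (iter j (fwd N A0) (idx A)) = cl A0 (top phi A)); last first.
    by rewrite /top; case: ifP => // _; rewrite -[in LHS](subrK n%:Z (iter _ _ _)) cl_per1.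
  have t0 : 0 <= top phi A < n%:Z.
    by rewrite /top; have := hphi A; have := idx_lt A; have := idx_ge0 A; case: ifP; lia.
  have tn : (absz (top phi A) < n)%N by lia.
  have -> : top phi A = idx (Ordinal tn) by rewrite /idx /=; lia.
  by rewrite cl_idx.
have baseE A : cl A0 (base phi A) = A.
  rewrite /base; case: ifP => _; last by rewrite cl_idx.
  by rewrite -(cl_per1 A0 (idx A - n%:Z)) subrK cl_idx.
have itE A : iter j (fwd N A0) (base phi A) = top phi A.
  rewrite /base /top; case: ifP => // _.
  by have := iter_cm_per fg j (idx A - n%:Z); rewrite subrK /phi => ->; rewrite addrK.
split=> A B.
- exact: pca_bb.
- by rewrite (power_beg_lt A0 pN) -topE /idx lez_nat.
- by rewrite (power_lt_beg A0 pN) -topE /idx ltz_nat.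
- have rank_lt (X Y : 'I_n) : top phi X = top phi Y -> base phi X < base phi Y ->
      aend (power N j) X < aend (power N j) Y.
    move=> tXY bXY; have [_ _ _ spec] := power_end A0 pN j X.
    rewrite spec; last by apply: val_inj; apply/eqP; rewrite -eqz_nat; apply/eqP; rewrite -!/(idx _) !topE.
    by rewrite -(baseE X) -(baseE Y); apply: pow_rank_lt => //; rewrite !itE.
  have top_lt (X Y : 'I_n) : top phi X < top phi Y ->
      aend (power N j) X < aend (power N j) Y.
    rewrite -!topE /idx ltz_nat => lt.
    have [lt' _ _ _] := power_end A0 pN j Y.
    by apply: lt_trans lt'; rewrite (power_lt_beg A0 pN).
  have mono := iter_cm_mono fg j.
  apply/idP/idP => [lt|lt].
    rewrite ltNge le_eqVlt; apply/negP => /orP[/eqP E|lt'].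
      by move: lt; rewrite -(baseE A) -(baseE B) E ltxx.
    have [tBA|tAB|E] := ltgtP (top phi B) (top phi A).
    + by have := lt_trans lt (top_lt _ _ tBA); rewrite ltxx.
    + by have := mono _ _ (ltW lt'); rewrite !itE leNgt tAB.
    + by have := lt_trans lt (rank_lt _ _ E lt'); rewrite ltxx.
  have := mono _ _ (ltW lt); rewrite !itE le_eqVlt => /orP[/eqP E|]; last exact: top_lt.
  exact: rank_lt.
Qed.

End Code.

(** * Fixed points of [f] in a connected model *)

Section Connected.
Variables (R : realType) (n : nat) (M : arc_family R n) (A0 : 'I_n).
Hypothesis hM : is_pca M.
Hypothesis hconn : connected_model M.
Let f := fwd M A0.
Let g := bwd M A0.
Let fg : circle_map n f g := fwd_bwd A0 hM.
Let S := lift_beg M A0.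
Let T := lift_end M A0.

(* No arc lifted to ]u, v] meets an arc lifted to ]v, u + n]. *)

Lemma fixed_point_period u v : f u = u -> f v = v -> u < v -> v < u + n%:Z -> False.
Proof.
move=> fu fv uv vn; have [C0 bnd _ _ _] := hM.
pose block A := exists x, [/\ cl A0 x = A, u < x & x <= v].
have fix_lt w x y : f w = w -> x <= w -> w < y -> T x < S y.
  move=> fw xw wy; apply: le_lt_trans (_ : T w < _); first by rewrite lift_end_le.
  apply: lt_le_trans (_ : S (w + 1) <= _); last by rewrite lift_beg_le //; lia.
  have := lift_beg_neq_end A0 hM (w + 1) w; rewrite neq_lt => /orP[|//].
  by rewrite -fwdE // -/f fw; lia.
have fun_ : f (u + n%:Z) = u + n%:Z by rewrite (cm_per fg) fu.
have meet A B : arcs_meet M A B -> block A -> block B.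
  move=> /asboolP[q [[hq qA] [_ qB]]] [x [xA ux xv]]; subst A.
  have [y [yB uy yn]] := cl_lift A0 B (u + 1); exists y; split=> //; first lia.
  subst B; rewrite leNgt; apply/negP => vy.
  have [P [m [P1 P2 E]]] := lift_point A0 hM x hq.
  have [P' [m' [P1' P2' E']]] := lift_point A0 hM y hq.
  move: qA qB; rewrite (in_arcE hM P1 P2 hq E) (in_arcE hM P1' P2' hq E').
  move=> /andP[PT SP] /andP[PT' SP'].
  have h1 : T x < S y by apply: fix_lt fv xv vy.
  have h2 : T y < S (x + n%:Z) by apply: fix_lt fun_ _ _; lia.
  rewrite /S lift_beg_per1 // -/S in h2.
  have : (clen M * (m' - m)%:~R : R) = P' - P by rewrite rmorphB mulrBr /=; lra.
  have h3 : P < P' by rewrite /S /T in h1; lra.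
  have h4 : P' < P + clen M by rewrite /S /T in h2; lra.
  case: (lerP (m' - m) 0) => mm.
    have : (m' - m)%:~R <= 0 :> R by rewrite lerz0.
    by move=> h; have := ler_wpM2l (ltW C0) h; rewrite mulr0; lra.
  have : 1 <= (m' - m)%:~R :> R by rewrite ler1z -gtz0_ge1.
  by move=> h; have := ler_wpM2l (ltW C0) h; rewrite mulr1; lra.
have : block (cl A0 (u + n%:Z)).
  have : block (cl A0 v) by exists v.
  have /connectP[p pp ->] := hconn (cl A0 v) (cl A0 (u + n%:Z)).
  elim: p (cl A0 v) pp => //= B p IH A /andP[AB pp] bA.
  exact: IH pp (meet _ _ AB bA).
by case=> x [/cl_inj E ux xv]; have := E ltac:(lia) ltac:(lia); lia.
Qed.

(** The values a of [f] at 0 and b at a + 1 are fixed points. Connectedness excludes b < a + n, and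
    b >= a + n makes the fibre over a + n, or those below it, so short of room that g(a + 1) < g(a +
    n) <= a + 1 <= g(a + 1). *)
Lemma idempotent_not_varies : (forall x, f (f x) = f x) -> ~ fwd_varies M A0.
Proof.
move=> idem vary; set a := f 0; have fa : f a = a by rewrite idem.
set b := f (a + 1); have fb : f b = b by rewrite idem.
have ab : a < b by have := cm_ge fg (a + 1); rewrite -/b; lia.
have [lt|ge] := ltP b (a + n%:Z); first exact: (fixed_point_period fa fb ab lt).
have g1 : g (a + n%:Z) <= a + 1 by rewrite -(cm_gal fg).
have g2 : a < g (a + 1) by rewrite -(cm_gt fg) fa; lia.
have := vary a; rewrite -/g -(cm_adj_per fg) => g3.
have g4 : a + 1 <= g (a + 1) by rewrite -ltzD1 ltrD2r.
by have := lt_le_trans (lt_le_trans g3 g1) g4; rewrite ltxx.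
Qed.

End Connected.

Section Multiplicative.
Variables (R : realType) (n k : nat) (U : arc_family R n) (A0 : 'I_n).
Hypothesis hA0 : A0 = 0%N :> nat.
Hypothesis pU : is_pca U.
Let f := fwd U A0.
Hypothesis short : forall i, (i <= k)%N -> forall x, iter i f x < x + n%:Z.
Variables (l' : nat).

Lemma arc_lenE A : arc_len U A = lift_end U A0 (idx A) - lift_beg U A0 (idx A).
Proof.
rewrite -[idx A]addr0 -[0](mulr0 n%:Z) lift_beg_idx // lift_end_idx // mulr0 add0r addr0.
by rewrite /arc_len; case: ifP => _; rewrite ?mulr1 ?mulr0; lra.
Qed.

Lemma modr_quo (x c : R) : 0 < c -> exists q : int, 0 <= modr x c < c /\ modr x c = x - c * q%:~R.
Proof.
move=> c0; exists (Num.floor (x / c)); split=> //; rewrite /modr.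
have := floor_itv (x / c); rewrite intrD => /andP[h1 h2].
by move: h1 h2; rewrite ler_pdivlMr // ltr_pdivrMr //; lra.
Qed.

(** The power is coded by f^i, and it passes on to the multiple the property that no extreme
    precedes s(A0). Both families then have codes, which agree because the order of the extremes is
    the same. *)
Lemma times_fwd i : is_pca (times l' i U) -> (i <= k)%N ->
  equivalent (times l' i U) (power U i) ->
  forall x, fwd (times l' i U) A0 x = iter i f x.
Proof.
move=> pV ik eqv; set V := times l' i U in pV eqv *; have n0 := ord_gt0 A0.
have fg := fwd_bwd A0 pU; have cP := power_code pU (short ik).
have bb A B : (abeg V A < abeg V B) = (idx A < idx B) by apply: pca_bb pV A B.
have same := equivalent_same bb (code_bb cP) eqv.
have hphi (A : 'I_n) : idx A <= iter i f (idx A) < idx A + n%:Z.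
  by rewrite (short ik) andbT; apply: (iter_cm_ge fg).
have zV : zero_normalized V A0.
  move=> b A; rewrite leNgt; change (~~ (extreme V b A < extreme V false A0)).
  rewrite same; case: b => /=.
    rewrite (code_eb cP) -leNgt {1}/idx hA0 /top /=; move: (hphi A) (idx_ge0 A).
    rewrite -/f; case: ifP; lia.
  by rewrite (pca_bb pU) /idx hA0; lia.
have cV := pca_code pV hA0 zV.
have hphi' (A : 'I_n) : idx A <= fwd V A0 (idx A) < idx A + n%:Z.
  by rewrite (fwd_lt A0 pV) (fwd_ge A0 pV).
have E := code_uniq cV cP hphi' hphi same.
move=> x; rewrite (cl_decomp A0 x) -/(idx _).
rewrite (per_mulz (fwd_per A0 pV)) (per_mulz (iter_cm_per fg i)).
by rewrite E.
Qed.

End Multiplicative.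

(** * From a multiplicative model to the ratios *)

Section Forward.
Variables (R : realType) (n k : nat) (M U : arc_family R n) (A0 : 'I_n).
Hypothesis hA0 : A0 = 0%N :> nat.
Hypothesis hM : is_pca M.
Hypothesis hconn : connected_model M.
Hypothesis h0 : zero_normalized M A0.
Hypothesis pU : is_pca U.
Hypothesis MU : equivalent M U.
Let f := fwd M A0.

Let same : forall a b A B, (extreme M a A < extreme M b B) = (extreme U a A < extreme U b B).
Proof. by apply: equivalent_same MU => A B; apply: pca_bb. Qed.

Lemma equivalent_fwd x : fwd U A0 x = f x.
Proof.
have zU : zero_normalized U A0.
  by move=> b A; rewrite leNgt; have := h0 b A; rewrite leNgt -(same b false).
have hphi (N : arc_family R n) (pN : is_pca N) (A : 'I_n) : idx A <= fwd N A0 (idx A) < idx A + n%:Z.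
  by rewrite (fwd_lt A0 pN) (fwd_ge A0 pN).
have E := code_uniq (pca_code hM hA0 h0) (pca_code pU hA0 zU) (hphi M hM) (hphi U pU) same.
rewrite (cl_decomp A0 x) -/(idx _) /f.
by rewrite (per_mulz (fwd_per A0 hM)) (per_mulz (fwd_per A0 pU)) E.
Qed.

Hypothesis short : forall i, (i <= k)%N -> forall x, iter i f x < x + n%:Z.
Variables (c' l' : nat).
Hypothesis caU : is_ca c' l' U.
Hypothesis timesU : forall i, (i <= k)%N ->
  is_uca (times l' i U) /\ equivalent (times l' i U) (power U i).

Let C := clen U.
Let S := lift_beg U A0.
Let C_gt0 : 0 < C. Proof. by case: pU. Qed.

Let end_eq x : lift_end U A0 x = S x + l'.+1%:R.
Proof.
have [_ _ len _] := caU; have := len (cl A0 x); rewrite (arc_lenE _ A0).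
rewrite -[idx _]addr0 -[0](mulr0 n%:Z) lift_beg_idx lift_end_idx mulr0 add0r addr0.
move=> <-; rewrite /S /lift_beg /lift_end mulrzDr; ring.
Qed.

Let times_end i x : exists m : int,
  lift_end (times l' i U) A0 x = S x + (i * l').+1%:R + C * m%:~R.
Proof.
have [q [_ E]] := modr_quo (abeg U (cl A0 x) + (i * l').+1%:R) C_gt0.
exists ((external (times l' i U) (cl A0 x) : nat)%:Z - q).
by rewrite /lift_end /= E /S /lift_beg -/C !mulrzDr mulrNz; ring.
Qed.

Let itU i x : iter i (fwd U A0) x = iter i f x.
Proof. by elim: i => //= i ->; rewrite equivalent_fwd. Qed.

Let tfwd i : (i <= k)%N -> forall x, fwd (times l' i U) A0 x = iter i f x.
Proof.
move=> ik x; have [[pV _] eqv] := timesU ik.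
rewrite (times_fwd hA0 pU _ pV ik eqv) ?itU // => j jk y.
by rewrite itU short.
Qed.

Let end_bnd i x : (i <= k)%N -> S x < lift_end (times l' i U) A0 x < S x + C.
Proof.
move=> ik; have [[pV _] _] := timesU ik.
have h1 := lift_beg_lt_end A0 pV x; have h2 := lift_end_lt_beg A0 pV x.
by rewrite /S; apply/andP; split; [exact: h1|exact: h2].
Qed.

Let l'C : l'.+1%:R < C.
Proof. by have := lift_end_lt_beg A0 pU 0; rewrite end_eq -/S -/C; lra. Qed.

(* If the arcs of i x U wrapped around the circle then, for the least such i,
   they would be shorter than those of U, so that f o f = f. *)
Lemma no_wrap i : (i <= k)%N -> fwd_varies M A0 -> (i * l').+1%:R < C.
Proof.
move=> ik nd; rewrite ltNge; apply/negP => Ci.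
have [j Cj jmin] : exists2 j, C <= (j * l').+1%:R & forall j', C <= (j' * l').+1%:R -> (j <= j')%N.
  have ex : exists j, C <= (j * l').+1%:R by exists i.
  by case: (ex_minnP ex) => j; exists j.
have jk : (j <= k)%N by apply: leq_trans (jmin _ Ci) ik.
case: j Cj jmin jk => [|[|j]] Cj jmin jk.
- have : (1 : R) <= l'.+1%:R by rewrite ler1n.
  by have := l'C; rewrite mul0n in Cj; lra.
- by have := l'C; rewrite mul1n in Cj; lra.
have Cj1 : (j.+1 * l').+1%:R < C.
  by rewrite ltNge; apply/negP => /jmin; rewrite ltnn.
have Ej : (j.+2 * l').+1%:R = (j.+1 * l').+1%:R + l'%:R :> R.
  by rewrite -natrD; congr (_%:R); lia.
have ll : (l'%:R : R) < l'.+1%:R by rewrite ltr_nat.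
have lC := l'C.
apply: (idempotent_not_varies hM hconn _ nd) => x.
have fg := fwd_bwd A0 hM.
apply/eqP; rewrite eq_le (cm_ge fg) andbT.
apply: le_trans (_ : iter j.+2 f x <= _); first exact: (iter_cm_le fg (i := 2)).
rewrite -[X in _ <= X]/(f x) -[X in _ <= X]equivalent_fwd fwdE // end_eq.
have [m Em] := times_end j.+2 x; have /andP[e1 e2] := end_bnd x jk.
have [[pV _] _] := timesU jk.
(* The multiple of level j + 1 fits in the circle and the next one does not, so exactly one turn is
   subtracted. *)
have Ee : lift_end (times l' j.+2 U) A0 x = S x + (j.+2 * l').+1%:R - C.
  apply: (@circle_congr _ _ C_gt0 _ _ (S x) (m + 1)); rewrite ?Em ?mulrzDr; rewrite ?Em in e1 e2.
  - ring.
  - exact: ltW.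
  - by [].
  - lra.
  - lra.
have : iter j.+2 f x <= fwd (times l' j.+2 U) A0 x by rewrite tfwd.
rewrite fwdE // Ee -[lift_beg _ _ _]/(S _) -/S.
by rewrite Ej; lra.
Qed.

(** The beginning points of U form a potential: the head of an i-nose begins after the end of an arc
    of length i l' + 1, and for a hollow the strict bound l' + 1 on the distance becomes l' by
    integrality. *)
Lemma multiplicative_ratio : ((ratiok M k)%:E < RATIOk M k)%E.
Proof.
apply: (@potential_ratio R n k M R (abeg U) C l'%:R) => // x xS.
have [_ _ _ ints] := caU.
have [/intrP[a Ea] /intrP[b Eb]] := (ints false (src x), ints false (tgt x)).
have [_ EC _ _] := caU; rewrite /= in Ea Eb.
have hS : S (head_lift x) = abeg U (tgt x) - C * (ext x)%:~R.
  have -> : head_lift x = idx (tgt x) + n%:Z * - ext x by rewrite /head_lift mulrN.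
  by rewrite /S lift_beg_idx mulrNz mulrN.
have sS : S (idx (src x)) = abeg U (src x).
  by rewrite -[idx _]addr0 -[0](mulr0 n%:Z) /S lift_beg_idx mulr0 addr0.
have := edge_step hM short 0 xS; rewrite mulr0 !addr0.
case K: (kind x) => [i|].
  move=> [hx ->]; rewrite /=.
  have ik : (i <= k)%N by rewrite -ltnS.
  have iC : (i * l').+1%:R < C.
    have [nd|nnd] := pselect (fwd_varies M A0); first exact: no_wrap.
    have [a' deg] := fwd_constant hM nnd.
    (* When [f] is constant on a period H_l is undefined, so all the noses are 0-noses. *)
    have i0 : i = 0%N :> nat.
      case: x K xS {hx Ea Eb hS sS} => [[kx A] B]; rewrite /kind /= => ->.
      rewrite !inE /= => /andP[/andP[_ /eqP]]; case: (i : nat) => // i'.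
      by rewrite /Hl_iter /=; case: (iter _ _ _) => //= B'; rewrite (constant_Hl hM deg).
    have : (1 : R) <= l'.+1%:R by rewrite ler1n.
    by rewrite i0 mul0n; have := l'C; lra.
  have [[pV _] _] := timesU ik.
  have [m Em] := times_end i (idx (src x)); have /andP[e1 e2] := end_bnd (idx (src x)) ik.
  have i1 : (1 : R) <= (i * l').+1%:R by rewrite ler1n.
  have Ee := circle_congr C_gt0 Em (ltW e1) e2 (_ : S (idx (src x)) <= _) (_ : _ < S (idx (src x)) + C).
  have {}Ee := Ee ltac:(lra) ltac:(lra).
  have : ~~ (head_lift x <= fwd (times l' i U) A0 (idx (src x))).
    by rewrite tfwd // -hx -ltNge ltzD1.
  rewrite fwdE // Ee -leNgt -[lift_beg _ _ _]/(S _) hS sS.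
  by rewrite -natr1 natrM -pmulrn; lra.
move=> [fh _ ->]; rewrite /= addr0.
have : idx (src x) <= fwd U A0 (head_lift x) by rewrite equivalent_fwd /f fh.
rewrite fwdE // end_eq -/S hS sS Ea Eb /C EC -[c'%:R]/((c'%:Z)%:~R) -[l'.+1%:R]/((l'.+1%:Z)%:~R).
rewrite -[l'%:R]/((l'%:Z)%:~R) -!rmorphM -!rmorphB -!rmorphD /= ltr_int ler_int.
lia.
Qed.

End Forward.

(** * From a potential to a multiplicative model *)

Section Construct.
Variables (R : realType) (n k : nat) (M : arc_family R n) (A0 : 'I_n).
Hypothesis hA0 : A0 = 0%N :> nat.
Hypothesis hM : is_pca M.
Hypothesis h0 : zero_normalized M A0.
Hypothesis k_gt0 : (0 < k)%N.
Let f := fwd M A0.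
Let fg : circle_map n f (bwd M A0) := fwd_bwd A0 hM.
Hypothesis short : forall i, (i <= k)%N -> forall x, iter i f x < x + n%:Z.
Variables (p : int -> int) (c : int) (l : nat).
Hypothesis pper : forall x, p (x + n%:Z) = p x + c.
Hypothesis pnose : forall i, (i <= k)%N -> forall x,
  p x + (i * l)%N%:Z + 2 <= p (iter i f x + 1).
Hypothesis phollow : forall x, p (f x) <= p x + l%:Z.

Let n_gt0 : (0 < n)%N := ord_gt0 A0.

Let p_lt x y : x < y -> p x < p y.
Proof.
have step z : p z < p (z + 1).
  by have := @pnose 0%N isT z; rewrite mul0n /=; lia.
move=> xy; have -> : y = x + 1 + (absz (y - x - 1)%R)%:Z by lia.
elim: (absz _) => [|m IH]; first by rewrite addr0.
by apply: lt_trans IH _; rewrite -addn1 PoszD addrA.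
Qed.

Let p_ltE x y : (p x < p y) = (x < y).
Proof. by apply: (leW_mono (le_mono _)) => a b; apply: p_lt. Qed.

Let p_inj x y : p x = p y -> x = y.
Proof. by case: (ltgtP x y) => // /p_lt; lia. Qed.

Let pperz x q : p (x + n%:Z * q) = p x + c * q.
Proof. by rewrite (per_mulz pper) mulrzz. Qed.

Let c_gt0 : 0 < c.
Proof.
have n0 : 0 < 0 + n%:Z by rewrite add0r ltz_nat.
by have := p_lt n0; rewrite pper ltrDl.
Qed.

Let C : R := c%:~R.

Let C_gt0 : 0 < C. Proof. by rewrite ltr0z. Qed.

(** The arcs have length i l + 1; [times l i (model 1)] is convertible to this family. *)
Let model (i : nat) : arc_family R n :=
  ArcFamily C (fun A => (p (idx A) - p 0)%:~R)
    (fun A => modr ((p (idx A) - p 0)%:~R + (i * l).+1%:R) C).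

Let S (x : int) : R := (p x - p 0)%:~R.

Let lift_begE i x : lift_beg (model i) A0 x = S x.
Proof.
rewrite /S {2}(cl_decomp A0 x) pperz -/(idx _) /lift_beg /=.
by rewrite !rmorphB /= mulrzDr rmorphM /= -/C; ring.
Qed.

Section Level.
Variable i : nat.
Hypothesis ik : (i <= k)%N.
Let w : R := (i * l).+1%:R.

Let pf x : p (iter i f x) < p x + (i * l).+1%:Z.
Proof.
suff H j : p (iter j f x) <= p x + (j * l)%N%:Z by have := H i; lia.
elim: j => [|j IH]; first by rewrite mul0n addr0.
by have := phollow (iter j f x); rewrite /= mulSn; lia.
Qed.

Let pf1 x : p x + (i * l).+1%:Z < p (iter i f x + 1).
Proof. by have := pnose ik x; lia. Qed.

Let S_lt x y : (S x < S y) = (x < y).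
Proof. by rewrite /S ltr_int ltrD2r p_ltE. Qed.

Let w_int x : S x + w = (p x + (i * l).+1%:Z - p 0)%:~R.
Proof. by rewrite /S /w -[_.+1%:R]/((_.+1%:Z)%:~R) -rmorphD; congr (_%:~R); lia. Qed.

(** The end p(x) + i l + 1 lies strictly between the values of p at f^i(x) and at its successor,
    thanks to the 2 in [pnose]. *)
Let fwd_model_lt x y : (S y < S x + w) = (y <= iter i f x).
Proof.
rewrite w_int /S ltr_int ltrD2r; have h1 := pf x; have h2 := pf1 x.
have [le|gt] := lerP y (iter i f x).
  have : p y <= p (iter i f x) by rewrite leNgt p_ltE -leNgt.
  lia.
have : p (iter i f x + 1) <= p y by rewrite leNgt p_ltE -leNgt; lia.
lia.
Qed.

Let fwd_model_gt x y : (S x + w < S y) = (iter i f x < y).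
Proof.
rewrite w_int /S ltr_int ltrD2r; have h1 := pf x; have h2 := pf1 x.
have [le|gt] := lerP y (iter i f x).
  have : p y <= p (iter i f x) by rewrite leNgt p_ltE -leNgt.
  lia.
have : p (iter i f x + 1) <= p y by rewrite leNgt p_ltE -leNgt; lia.
lia.
Qed.

Let S_per x q : S (x + n%:Z * q) = S x + C * q%:~R.
Proof. by rewrite /S pperz -rmorphM -rmorphD; congr (_%:~R); lia. Qed.

Let w_lt : w < C.
Proof.
have : p 0 + (i * l).+1%:Z < p 0 + c.
  apply: lt_le_trans (pf1 0) _; rewrite -pper leNgt p_ltE -leNgt.
  by have := short ik 0; lia.
by rewrite ltrD2l -(ltr_int R).
Qed.

Let w_gt0 : 0 < w. Proof. by rewrite ltr0n. Qed.

Let endE x : exists m : int, aend (model i) (cl A0 x) = S x + w - C * m%:~R.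
Proof.
have [q [_ E]] := modr_quo (abeg (model i) (cl A0 x) + w) C_gt0.
exists (q + (x %/ n%:Z)%Z); rewrite -(lift_begE i) /lift_beg /= -/C.
by rewrite E /= mulrzDr; ring.
Qed.

Let begE x : exists m : int, abeg (model i) (cl A0 x) = S x - C * m%:~R.
Proof.
by exists (x %/ n%:Z)%Z; rewrite -(lift_begE i) /lift_beg /= -/C; ring.
Qed.

Let bounds b A : 0 <= extreme (model i) b A < C.
Proof.
case: b => /=.
  by have [q []] := modr_quo ((p (idx A) - p 0)%:~R + (i * l).+1%:R) C_gt0.
have h1 : p (idx A) < p 0 + c by rewrite -pper add0r p_ltE idx_lt.
have h2 : p 0 <= p (idx A) by rewrite leNgt p_ltE -leNgt idx_ge0.
by rewrite ler0z ltr_int; lia.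
Qed.

Let beg_neq_end A B : abeg (model i) A <> aend (model i) B.
Proof.
rewrite -[A](cl_idx A0) -[B](cl_idx A0) -!/(idx _).
have [m ->] := endE (idx B); have [m' ->] := begE (idx A) => E.
have Sz : S (idx A + n%:Z * (m - m')) = S (idx B) + w by rewrite S_per rmorphB /=; lra.
have := fwd_model_lt (idx B) (idx A + n%:Z * (m - m')).
have := fwd_model_gt (idx B) (idx A + n%:Z * (m - m')).
by rewrite Sz !ltxx; lia.
Qed.

Lemma model_pca : is_pca (model i).
Proof.
split=> // [a b A B|A B AB|A B sub].
- case: a; case: b; rewrite /extreme -[A](cl_idx A0) -[B](cl_idx A0) -!/(idx _).
  + have [m ->] := endE (idx A); have [m' ->] := endE (idx B) => E.
    congr pair; suff -> : idx A = idx B + n%:Z * (m - m') by rewrite (cl_per A0).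
    apply: p_inj; rewrite pperz; apply/eqP; rewrite -(eqr_int R) rmorphD rmorphM rmorphB /=.
    by move: E; rewrite /S !rmorphB /= -/C => E; apply/eqP; lra.
  + by move=> /esym/beg_neq_end.
  + by move=> /beg_neq_end.
  + move=> /eqP; rewrite /= eqr_int => /eqP/addIr/p_inj E; congr pair.
    by rewrite -[A](cl_idx A0) -[B](cl_idx A0) -!/(idx _) E.
- by rewrite /= ltr_int ltrD2r p_ltE /idx ltz_nat.
- apply: contrapT => AB; set a := idx A.
  have [b [Eb ba bn]] := cl_lift A0 B (a - n%:Z).
  have ab : a - n%:Z != b.
    apply: contra_notN AB => /eqP E; rewrite -Eb -E -[A](cl_idx A0) -/(idx A) -/a.
    by rewrite -[in LHS](subrK n%:Z a) cl_per1.
  have lo : S a - C < S b.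
    have -> : S a - C = S (a + n%:Z * -1) by rewrite S_per; lra.
    by rewrite S_lt; lia.
  have hi : S b < S a by rewrite S_lt; lia.
  (* The midpoint P lies in the arc of a, after the end of the arc of b and before the next lift of
     its beginning. *)
  pose x1 := Num.max (S a) (S b + w); pose x2 := Num.min (S a + w) (S b + C).
  have x12 : x1 < x2.
    have := w_lt; have := w_gt0; rewrite /x1 /x2 => h1 h2.
    by rewrite gt_max !lt_min; apply/andP; split; apply/andP; split; lra.
  pose P := (x1 + x2) / 2; have [P1 P2] : x1 < P /\ P < x2 by rewrite /P; lra.
  move: P1 P2; rewrite /x1 /x2 gt_max lt_min => /andP[P1 P2] /andP[P3 P4].
  have [q [hq Eq]] := modr_quo P C_gt0.
  have [ma Ea] := begE a; have [mb Eb'] := begE b.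
  have [ma' Ea'] := endE a; have [mb' Eb''] := endE b.
  rewrite {1}/a cl_idx in Ea Ea'; rewrite Eb in Eb' Eb''.
  have wC := w_lt; have w0 := w_gt0.
  have HA : in_arc (abeg (model i) A) (aend (model i) A) (modr P C) =
      (P < S a + w) && (S a < P).
    by apply: (in_arc_lift C_gt0 (bounds false A) (bounds true A) hq
         (a := ma) (b := ma') (m := q)); rewrite /extreme; lra.
  have HB : in_arc (abeg (model i) B) (aend (model i) B) (modr P C) =
      (P < S b + w) && (S b < P).
    by apply: (in_arc_lift C_gt0 (bounds false B) (bounds true B) hq
         (a := mb) (b := mb') (m := q)); rewrite /extreme; lra.
  have inA : arc_points (model i) A (modr P C).
    by split=> //; rewrite HA P3 P1.
  by have [_] := sub _ inA; rewrite HB => /andP[]; lra.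
Qed.

Lemma model_end x : lift_end (model i) A0 x = S x + w.
Proof.
have [m Em] := endE x; have wC := w_lt; have w0 := w_gt0.
have h1 := lift_beg_lt_end A0 model_pca x; have h2 := lift_end_lt_beg A0 model_pca x.
rewrite lift_begE -[clen _]/C in h1 h2.
apply: (circle_congr C_gt0 (x := S x)
  (m := (x %/ n%:Z)%Z + external (model i) (cl A0 x) - m)); try lra.
by rewrite {1}/lift_end Em rmorphB mulrBr /= -/C; lra.
Qed.

Lemma model_fwd x : fwd (model i) A0 x = iter i f x.
Proof.
have H y : (y <= fwd (model i) A0 x) = (y <= iter i f x).
  by rewrite (fwdE _ model_pca) lift_begE model_end fwd_model_lt.
by apply/eqP; rewrite eq_le -H lexx H lexx.
Qed.

Lemma model_code : extreme_code (model i) (fun A => iter i f (idx A)).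
Proof.
have z : zero_normalized (model i) A0.
  by move=> b A; rewrite /= /idx hA0 subrr; case/andP: (bounds b A).
have [bb be eb ee] := pca_code model_pca hA0 z.
have E : (fun A : 'I_n => fwd (model i) A0 (idx A)) = (fun A => iter i f (idx A)).
  by apply/funext => A; rewrite model_fwd.
by rewrite E in be eb ee.
Qed.

Lemma model_len A : arc_len (model i) A = w.
Proof. by rewrite (arc_lenE _ A0) model_end lift_begE; lra. Qed.

End Level.

(** For U = [model 1], both M and U are coded by [f], while the i-th multiple and the i-th power of
    U are both coded by f^i. *)
Lemma multiplicative_model : exists U : arc_family R n,
  k_multiplicative k U /\ equivalent M U.
Proof.
have k1 : (1 <= k)%N by [].
exists (model 1); split; last first.
  exact: code_equivalent (pca_code hM hA0 h0) (model_code k1).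
exists (absz c), l; split.
  split.
  - split; first exact: model_pca.
    by move=> A B; rewrite !model_len.
  - by rewrite /= /C -{1}[c]gez0_abs ?(ltW c_gt0) // -pmulrn.
  - by move=> A; rewrite model_len // mul1n.
  - case=> A; rewrite /= ?intr_int //.
    rewrite /modr /C -[(_.+1)%:R]/((_.+1%:Z)%:~R) -rmorphD -rmorphM -rmorphB; exact: intr_int.
move=> i ik; rewrite -[times l i (model 1)]/(model i); split.
  split; first exact: model_pca.
  by move=> A B; rewrite !model_len.
apply: code_equivalent (model_code ik) _.
have E : (fun A : 'I_n => iter i f (idx A)) = (fun A => iter i (fwd (model 1) A0) (idx A)).
  by apply/funext => A; apply: eq_iter => x; rewrite model_fwd.
rewrite E; apply: power_code; first exact: model_pca.
move=> x; rewrite (_ : iter i _ x = iter i f x) ?short //.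
by apply: eq_iter => y; rewrite model_fwd.
Qed.
End Construct.

(** * Integral potentials and the models they define *)

Lemma common_denominator (I : finType) (h : I -> rat) :
  exists2 D : nat, (0 < D)%N & forall i, exists z : int, D%:R * h i = z%:~R.
Proof.
suff [D D0 Dh] : exists2 D : nat, (0 < D)%N &
    forall i, i \in enum I -> exists z : int, D%:R * h i = z%:~R.
  by exists D => // i; apply: Dh; rewrite mem_enum.
elim: (enum I) => [|i s [D D0 Dh]]; first by exists 1%N.
have d0 := denq_gt0 (h i).
exists (D * absz (denq (h i)))%N; first by rewrite muln_gt0 D0 absz_gt0 denq_eq0.
have dE : (absz (denq (h i)))%:R = (denq (h i))%:~R :> rat.
  by rewrite pmulrn gez0_abs // ltW.
move=> j; rewrite inE natrM dE => /orP[/eqP ->|/Dh[z Ez]].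
  exists (D%:Z * numq (h i)); rewrite -mulrA -{2}(divq_num_den (h i)).
  by rewrite [_ * (_ / _)]mulrC divfK ?intr_eq0 ?denq_eq0 // rmorphM.
by exists (denq (h i) * z); rewrite rmorphM /= -Ez mulrAC mulrC mulrCA mulrA.
Qed.

Section Backward.
Variables (R : realType) (n k : nat) (M : arc_family R n) (A0 : 'I_n).
Hypothesis hA0 : A0 = 0%N :> nat.
Hypothesis hM : is_pca M.
Hypothesis h0 : zero_normalized M A0.
Hypothesis k_gt0 : (0 < k)%N.
Let f := fwd M A0.
Let fg : circle_map n f (bwd M A0) := fwd_bwd A0 hM.
Hypothesis short : forall i, (i <= k)%N -> forall x, iter i f x < x + n%:Z.

(** A common denominator D of the potential and of c, which is the value at [None], makes all the
    data integral; l becomes D l, and the separation 2 becomes 2 D >= 2. *)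
Lemma pot_multiplicative (P : 'I_n -> rat) (c : rat) (l : nat) : fwd_varies M A0 ->
  (forall x, x \in Sgraph M k -> P (src x) + sep c l%:R x <= P (tgt x)) ->
  exists U : arc_family R n, k_multiplicative k U /\ equivalent M U.
Proof.
move=> nd PS; have n0 := ord_gt0 A0; set p := lift_pot A0 P c.
have pS := seps_of_pot hM k_gt0 short nd (ler0n _ l) PS.
have [D D0 Dh] := @common_denominator (option 'I_n) (fun o => oapp P c o).
have [c' Ec] := Dh None; rewrite /= in Ec.
have Dp x : exists z : int, D%:R * p x = z%:~R.
  have [z Ez] := Dh (Some (cl A0 x)); rewrite /= in Ez.
  exists (z + c' * (x %/ n%:Z)%Z).
  by rewrite /p /lift_pot mulrDr mulrA Ez Ec rmorphD rmorphM.
have [p' Ep'] := choice Dp.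
have D1 : (1 : rat) <= D%:R by rewrite ler1n.
apply: (@multiplicative_model R n k M A0 hA0 hM h0 k_gt0 short p' c' (D * l)).
- move=> x; apply/eqP; rewrite -(eqr_int rat) rmorphD /= -!Ep' -Ec -mulrDr.
  by rewrite /p (seps_per pS).
- move=> i ik x; rewrite -(ler_int rat) !rmorphD /= -!Ep' -pmulrn !natrM.
  have := seps_lt fg n0 k_gt0 pS x ik; rewrite -/p => le.
  have := ler_wpM2l (ler0n _ D) le; rewrite !mulrDr; lra.
- move=> x; rewrite -(ler_int rat) rmorphD /= -!Ep' -pmulrn natrM -mulrDr.
  by rewrite ler_wpM2l // (seps_le fg n0 k_gt0 pS).
Qed.

(** Here [f] sends each block of n points to its last point. Points are placed at distance 2 inside
    a block, so that l = 2n bounds its width, and k l is added between blocks to make room for all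
    the noses. *)
Lemma constant_multiplicative : ~ fwd_varies M A0 ->
  exists U : arc_family R n, k_multiplicative k U /\ equivalent M U.
Proof.
move=> nnd; have [a deg] := fwd_constant hM nnd; have n0 := ord_gt0 A0.
pose l := (2 * n)%N.
pose p (x : int) : int := 2 * x + (k * l)%N%:Z * ((x - a) %/ n%:Z)%Z.
have pE q r : 0 <= r -> r < n%:Z -> p (a + r + n%:Z * q) = 2 * (a + r + n%:Z * q) + (k * l)%N%:Z * q.
  move=> r0 rn; congr (_ + _ * _).
  rewrite (_ : _ - a = q * n%:Z + r); last ring.
  by rewrite divzMDl ?divz_small ?addr0 //; lia.
have rep x : exists q r, [/\ 0 <= r, r < n%:Z & x = a + r + n%:Z * q].
  have n1 : n%:Z != 0 by lia.
  exists ((x - a) %/ n%:Z)%Z, ((x - a) %% n%:Z)%Z; rewrite modz_ge0 // ltz_pmod //.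
  by split=> //; rewrite -addrA [_ + n%:Z * _]addrC mulrC -divz_eq; lia.
have fE q r : 0 <= r -> r < n%:Z -> f (a + r + n%:Z * q) = a + (n%:Z - 1) + n%:Z * q.
  move=> r0 rn; rewrite (per_mulz (cm_per fg)) mulrzz.
  have [E _] := deg (a + r) ltac:(lia) ltac:(lia).
  by rewrite [f _]E; lia.
have itE i q r : 0 <= r -> r < n%:Z ->
    iter i.+1 f (a + r + n%:Z * q) = a + (n%:Z - 1) + n%:Z * q.
  by elim: i r => [|i IH] r r0 rn; [exact: fE|rewrite iterSr fE // IH //; lia].
apply: (@multiplicative_model R n k M A0 hA0 hM h0 k_gt0 short p
  (2 * n%:Z + (k * l)%N%:Z) l).
- move=> x; have [q [r [r0 rn ->]]] := rep x.
  rewrite (_ : _ + n%:Z = a + r + n%:Z * (q + 1)); last ring.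
  by rewrite !pE //; ring.
- move=> i ik x; have [q [r [r0 rn ->]]] := rep x; rewrite pE //.
  case: i ik => [|i] ik.
    rewrite mul0n /=; have [E|ne] := eqVneq (r + 1) n%:Z.
      rewrite (_ : _ + 1 = a + 0 + n%:Z * (q + 1)); last by rewrite mulrDr mulr1; lia.
      by rewrite pE //; lia.
    rewrite (_ : _ + 1 = a + (r + 1) + n%:Z * q); last lia.
    by rewrite pE //; lia.
  rewrite itE // (_ : _ + 1 = a + 0 + n%:Z * (q + 1)); last by rewrite mulrDr mulr1; lia.
  have le : (i.+1 * l <= k * l)%N by rewrite leq_mul2r ik orbT.
  by rewrite pE // mulrDr [_ * (q + 1)]mulrDr !mulr1; lia.
- move=> x; have [q [r [r0 rn ->]]] := rep x; rewrite [fwd M A0 _]fE // !pE //; lia.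
Qed.

End Backward.

Theorem theorem10 (R : realType) (n k : nat) (M : arc_family R n) (A0 : 'I_n)
    (hM : is_pca M) (hconn : connected_model M)
    (hA0 : A0 = 0%N :> nat) (h0 : zero_normalized M A0)
    (hk1 : (1 <= k)%N) (hk : (k < omega M)%N) :
  let e : rat := (4 * n)%:R in
  let l : rat := e ^+ 3 in
  let c : rat := l * ratiok M k + e in
  [<-> exists (m : nat) (U : arc_family R m), k_multiplicative k U /\ equivalent M U;
       ((ratiok M k)%:E < RATIOk M k)%E;
       forall W, is_cycle (Sgraph M k) W -> (lexW M W < ((0, 0) : lexT))%O;
       acyclic (Rgraph M k A0);
       forall A : 'I_n, exists x : rat,
         dist (weight (@sep n k c l)) (Sgraph M k) A0 A = x%:E /\
         path_dist (weight (@sep n k c l)) (Rgraph M k A0) A0 A = x%:E].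
Proof.
move=> e l c; have short := omega_short A0 hM hk1 hk.
have reach lex_neg := reachable hM hk1 short lex_neg erefl erefl erefl hA0.
tfae.
- case=> m [U [[c' [l' [caU timesU]]] MU]].
  have nm : n = m by case: MU => h [/bij_eq_card]; rewrite !card_ord.
  subst m; have [[pU _] _ _ _] := caU.
  exact: (multiplicative_ratio hA0 hM hconn h0 pU MU short caU timesU).
- exact: (ratio_lex hM short).
- by move=> lex_neg; apply: lex_acyclic => //; apply: reach.
- move=> /acyclic_lex lex_neg A; apply: sep_dist => //; exact: reach.
- move=> d5; have [nd|nnd] := pselect (fwd_varies M A0); last first.
    by have [U HU] := constant_multiplicative hA0 hM h0 hk1 short nnd; exists n, U.
  (* The distances from [A0], finite by assumption, are a potential for [sep]. *)
  have [P HP] := choice d5.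
  have maxP A := proj1 (max_or_inftyP _ _) (proj1 (HP A)).
  have lE : l = ((4 * n) ^ 3)%N%:R by rewrite natrX.
  rewrite lE in maxP.
  have [U HU] : exists U : arc_family R n, k_multiplicative k U /\ equivalent M U.
    apply: (@pot_multiplicative R n k M A0 hA0 hM h0 hk1 short P c ((4 * n) ^ 3)) => // x xS.
    have [[W wW ->] _] := maxP (src x).
    have [_] := maxP (tgt x); apply; exists (W ++ [:: x]).
      by rewrite walk_cat -(walk_endP wW) wW /= xS !eqxx.
    by rewrite weight_cat (weight_cons _ x) weight_nil addr0.
  by exists n, U.
Qed.
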